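(* Suppose that $L$ is irreducible and $\rho>\lambda_0(1-\gamma)$. Let $\Phi(u)=\sum_{i=1}^np_i^{1/\gamma}u_i^{(\gamma-1)/\gamma}$ for $u\in\mathbb{R}^n_{++}$ and $\alpha=\dfrac{\gamma\,\Phi(b^0)}{\rho-\lambda_0(1-\gamma)}$. Then: (i) The function $v(k)=\frac{\alpha^\gamma}{1-\gamma}\langle k,b^0\rangle^{1-\gamma}$, $k\in X_{++}$, is a solution of $$\rho v(k)=\langle (L+A)k,\mathrm{D}v(k)\rangle+H_\gamma(\mathrm{D}v(k)),\qquad k\in X_{++}.$$ (ii) For each $k\in X_{++}$ the unique maximizer in the supremum defining $H_\gamma(\mathrm{D}v(k))$ is $\widehat c(\mathrm{D}v(k))=Fk$, where $F$ is the $n\times n$ matrix with entries $f_{ij}=\frac1\alpha\left(\frac{p_i}{b^0_i}\right)^{1/\gamma}b^0_j$. (iii) The value $g=\frac{\lambda_0-\rho}{\gamma}$ is an eigenvalue of $(L+A-F)^T$, with associated eigenvector $b^0$. (iv) The closed loop equation $K'(t)=(L+A-F)K(t)$, $t\ge0$, $K(0)=k$, has a unique solution $\widehat K^k$ for each $k\in\mathbb{R}^n$. Moreover, if $k\in X_{++}$, then $\langle\widehat K^k(t),b^0\rangle=\langle k,b^0\rangle e^{gt}$ for $t\ge0$, and hence $\widehat K^k(t)\in X_{++}$ for all $t\ge0$. (v) Let $k\in X_{++}$. The control $\widehat C$ with components $$\widehat C_i(t)=[F\widehat K^k(t)]_i=\frac1\alpha\left(\frac{p_i}{b^0_i}\right)^{1/\gamma}\langle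 k,b^0\rangle e^{gt},\qquad t\ge0,\ i=1,\dots,n,$$ belongs to $\mathcal{A}^{b^0}_{++}(k)$ and is optimal for the auxiliary problem defining $V_{b^0}(k)$. Moreover $V_{b^0}(k)=v(k)$. If, in addition, $\widehat C\in\mathcal{A}_+(k)$, then $\widehat C$ is optimal for the problem defining $V(k)$, and $V(k)=V_{b^0}(k)$. (vi) The control $\widehat C$ (given by the formula in (v)) is optimal for the problem defining $V(k)$ for every $k\in\mathbb{R}^n_+$ if and only if $w_{ij}\ge f_{ij}$ for all $i\ne j$. In this case, $V$ and $V_{b^0}$ coincide on $\mathbb{R}^n_+\setminus\{0\}$ and $V_{b^0}$ solves $\rho v(k)=\langle (L+A)k,\mathrm{D}v(k)\rangle+H_\gamma(\mathrm{D}v(k))$ for all $k\in\mathbb{R}^n_{++}$.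
   Context: $\mathbb{R}^n_+$ and $\mathbb{R}^n_{++}$ are the sets of vectors in $\mathbb{R}^n$ with all components $\ge 0$, resp. $>0$. Here $n\ge2$, $\rho>0$, $\gamma>0$ with $\gamma\ne1$, $p_1,\dots,p_n>0$, $A=\mathrm{diag}(A_1,\dots,A_n)$ with $A_i>0$. $W=(w_{ij})$ is a symmetric matrix of graph weights with $w_{ij}\ge0$, $w_{ii}=0$, and $L=(\ell_{ij})$ is given by $\ell_{ij}=w_{ij}$ for $i\neq j$ and $\ell_{ii}=-\sum_{j\ne i}w_{ij}$. $L$ irreducible means that the graph on $\{1,\dots,n\}$ with edges $\{i,j\}$ whenever $w_{ij}>0$ is connected. $\lambda_0$ is the largest eigenvalue of the symmetric matrix $L+A$ (it is simple when $L$ is irreducible) and $b^0\in\mathbb{R}^n_{++}$ is its strictly positive unit eigenvector. $X_{++}=\{x\in\mathbb{R}^n:\langle x,b^0\rangle>0\}$. For $k\in\mathbb{R}^n$ and $C\in L^1_{\mathrm{loc}}([0,+\infty);\mathbb{R}^n_+)$, $K^{k,C}$ is the solution of $K'(t)=(L+A)K(t)-C(t)$, $t\ge0$, $K(0)=k$. Let $\mathcal{A}_+(k)=\{C\in L^1_{\mathrm{loc}}([0,+\infty);\mathbb{R}^n_+):K^{k,C}(t)\in\mathbb{R}^n_+\ \forall t\ge0\}$ and $\mathcal{A}^{b^0}_{++}(k)=\{C\in L^1_{\mathrm{loc}}([0,+\infty);\mathbb{R}^n_+):\langle K^{k,C}(t),b^0\rangle>0\ \forall t\ge0\}$. With $J(C)=\int_0^{+\infty}e^{-\rho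 t}\sum_{i=1}^np_i\frac{C_i(t)^{1-\gamma}}{1-\gamma}\,dt$ (the integrand being $-\infty$ when some $C_i(t)=0$ and $\gamma>1$), set $V(k)=\sup_{C\in\mathcal{A}_+(k)}J(C)$ for $k\in\mathbb{R}^n_+$ and $V_{b^0}(k)=\sup_{C\in\mathcal{A}^{b^0}_{++}(k)}J(C)$ for $k\in X_{++}$. A control is optimal if it is admissible and attains the supremum. The Hamiltonian is $H_\gamma(q)=\sup_{c\in\mathbb{R}^n_+}\{-\langle c,q\rangle+\sum_{i=1}^np_i\frac{c_i^{1-\gamma}}{1-\gamma}\}$. *)

(* Defs.v *)
From HB Require Import structures.
From mathcomp Require Import all_boot all_order all_algebra.
From mathcomp Require Import all_classical all_reals all_analysis.
Set Implicit Arguments.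
Unset Strict Implicit.
Unset Printing Implicit Defensive.
Import Order.TTheory GRing.Theory Num.Theory.
Import numFieldNormedType.Exports.
Local Open Scope classical_set_scope.
Local Open Scope ring_scope.

Definition dotv (R : realType) (n : nat) (x y : 'cV[R]_n) : R :=
  \sum_(i < n) x i 0 * y i 0.

Definition nneg_cone (R : realType) (n : nat) : set 'cV[R]_n :=
  [set x | forall i, 0 <= x i 0].

Definition pos_cone (R : realType) (n : nat) : set 'cV[R]_n :=
  [set x | forall i, 0 < x i 0].

Definition half_space (R : realType) (n : nat) (b : 'cV[R]_n) : set 'cV[R]_n :=
  [set x | 0 < dotv x b].

Definition attains_sup (R : realType) (T : Type) (S : set T) (f : T -> \bar R)
    (x : T) : Prop :=
  S x /\ f x = ereal_sup [set f y | y in S].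

Definition graph_weights (R : realType) (n : nat) (W : 'M[R]_n) : Prop :=
  [/\ W^T = W, forall i j, 0 <= W i j & forall i, W i i = 0].

Definition graph_connected (R : realType) (n : nat) (W : 'M[R]_n) : Prop :=
  forall i j, connect (fun i j => 0 < W i j) i j.

Definition laplacian (R : realType) (n : nat) (W : 'M[R]_n) : 'M[R]_n :=
  \matrix_(i, j) (if i == j then - \sum_(l | l != i) W i l else W i j).

(* [eigenvalue] refers to row eigenvectors; it is only applied to
   symmetric matrices here, whose eigenvalues are all real. *)
Definition largest_eigenvalue (R : realType) (n : nat) (M : 'M[R]_n) (l : R) :
    Prop :=
  eigenvalue M l /\ forall mu, eigenvalue M mu -> mu <= l.

Definition eigenpair (R : realType) (n : nat) (M : 'M[R]_n) (l : R)
    (x : 'cV[R]_n) : Prop :=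
  x != 0 /\ M *m x = l *: x.

Definition pos_unit_eigenvector (R : realType) (n : nat) (M : 'M[R]_n) (l : R)
    (b : 'cV[R]_n) : Prop :=
  [/\ eigenpair M l b, pos_cone b & dotv b b = 1].

(* [0 `^ r = 0] for every [r != 0], so the value at 0 has to be set apart when
   [gamma > 1]. *)
Definition crra (R : realType) (gamma c : R) : \bar R :=
  if (1 < gamma) && (c == 0) then -oo%E
  else (c `^ (1 - gamma) / (1 - gamma))%:E.

Definition welfare (R : realType) (n : nat) (p : 'I_n -> R) (gamma : R)
    (c : 'cV[R]_n) : \bar R :=
  (\sum_(i < n) (p i)%:E * crra gamma (c i 0%R))%E.

Definition hamiltonian_cv (R : realType) (n : nat) (p : 'I_n -> R) (gamma : R)
    (q c : 'cV[R]_n) : \bar R :=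
  ((- dotv c q)%:E + welfare p gamma c)%E.

Definition hamiltonian (R : realType) (n : nat) (p : 'I_n -> R) (gamma : R)
    (q : 'cV[R]_n) : \bar R :=
  ereal_sup [set hamiltonian_cv p gamma q c | c in @nneg_cone R n].

Definition grad (R : realType) (n : nat) (f : 'cV[R]_n -> R) (x : 'cV[R]_n) :
    'cV[R]_n :=
  \col_i 'D_(delta_mx i 0) f x.

(* Classical solution on an open set [S] of
   [rho v(k) = <M k, Dv(k)> + H_gamma(Dv(k))]: [v] is finite and C^1 on [S] and
   the equation holds pointwise.  Value functions being extended-real valued,
   so is [v]. *)
Definition hjb_solution (R : realType) (n : nat) (p : 'I_n -> R)
    (gamma rho : R) (M : 'M[R]_n) (S : set 'cV[R]_n) (v : 'cV[R]_n -> \bar R) :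
    Prop :=
  forall k, S k ->
    let Dv := grad (fun x => fine (v x)) in
    [/\ v k \is a fin_num,
        differentiable (fun x => fine (v x)) k,
        {for k, continuous Dv} &
        (rho%:E * v k =
           (dotv (M *m k) (Dv k))%:E + hamiltonian p gamma (Dv k))%E].

(* L^1_loc([0, +oo); R^n_+): representatives that are nonnegative everywhere on
   [0, +oo); values at negative times are irrelevant. *)
Definition control (R : realType) (n : nat) (C : R -> 'cV[R]_n) : Prop :=
  (forall t, 0 <= t -> nneg_cone (C t)) /\
  (forall (i : 'I_n) (T : R), 0 <= T ->
     (@lebesgue_measure R).-integrable `[0, T] (fun t => (C t i 0)%:E)).

(* Caratheodory solution of [K' = M K - C], [K(0) = k], on [0, +oo): as C is
   only locally integrable, the equation is taken in its integral form. *)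
Definition trajectory (R : realType) (n : nat) (M : 'M[R]_n) (k : 'cV[R]_n)
    (C : R -> 'cV[R]_n) (K : R -> 'cV[R]_n) : Prop :=
  {within `[0, +oo[, continuous K} /\
  forall (t : R) (i : 'I_n), 0 <= t ->
    K t i 0 =
      k i 0 + (\int[@lebesgue_measure R]_(s in `[0, t]) (M *m K s - C s) i 0)%R.

Definition admissible (R : realType) (n : nat) (M : 'M[R]_n)
    (S : set 'cV[R]_n) (k : 'cV[R]_n) : set (R -> 'cV[R]_n) :=
  [set C | control C /\
           exists K, trajectory M k C K /\ forall t, 0 <= t -> S (K t)].

Definition payoff (R : realType) (n : nat) (p : 'I_n -> R) (gamma rho : R)
    (C : R -> 'cV[R]_n) : \bar R :=
  (\int[@lebesgue_measure R]_(t in `[0%R, +oo[)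
     ((expR (- (rho * t)))%:E * welfare p gamma (C t)))%E.

Definition value (R : realType) (n : nat) (p : 'I_n -> R) (gamma rho : R)
    (M : 'M[R]_n) (S : set 'cV[R]_n) (k : 'cV[R]_n) : \bar R :=
  ereal_sup [set payoff p gamma rho C | C in admissible M S k].

Definition optimal (R : realType) (n : nat) (p : 'I_n -> R) (gamma rho : R)
    (M : 'M[R]_n) (S : set 'cV[R]_n) (k : 'cV[R]_n) (C : R -> 'cV[R]_n) :
    Prop :=
  attains_sup (admissible M S k) (payoff p gamma rho) C.

(* Classical solution of [K' = M K], [K(0) = k], on [0, +oo): the derivative is
   relative to [0, +oo), hence one-sided at 0. *)
Definition linear_ode_solution (R : realType) (n : nat) (M : 'M[R]_n)
    (k : 'cV[R]_n) (K : R -> 'cV[R]_n) : Prop :=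
  K 0 = k /\
  forall t, 0 <= t ->
    (s - t)^-1 *: (K s - K t) @[s --> within (fun s => 0 <= s) t^']
      --> M *m K t.

Definition Phi (R : realType) (n : nat) (p : 'I_n -> R) (gamma : R)
    (u : 'cV[R]_n) : R :=
  \sum_(i < n) p i `^ gamma^-1 * u i 0 `^ ((gamma - 1) / gamma).

Definition explicit_value (R : realType) (n : nat) (gamma alpha : R)
    (b k : 'cV[R]_n) : R :=
  alpha `^ gamma / (1 - gamma) * dotv k b `^ (1 - gamma).

Definition feedback (R : realType) (n : nat) (p : 'I_n -> R) (gamma alpha : R)
    (b : 'cV[R]_n) : 'M[R]_n :=
  \matrix_(i, j) (alpha^-1 * (p i / b i 0) `^ gamma^-1 * b j 0).

Definition explicit_control (R : realType) (n : nat) (p : 'I_n -> R)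
    (gamma alpha g : R) (b k : 'cV[R]_n) (t : R) : 'cV[R]_n :=
  \col_i (alpha^-1 * (p i / b i 0) `^ gamma^-1 * dotv k b * expR (g * t)).

(* Main.v *)
Require Import Defs.
From HB Require Import structures.
From mathcomp Require Import all_boot all_order all_algebra.
From mathcomp Require Import all_classical all_reals all_analysis.
From mathcomp Require Import measurable_realfun.
From mathcomp Require Import ring lra.
Set Implicit Arguments.
Unset Strict Implicit.
Unset Printing Implicit Defensive.
Import Order.TTheory GRing.Theory Num.Theory.
Import numFieldNormedType.Exports.
Local Open Scope classical_set_scope.
Local Open Scope ring_scope.

(** Since [M b = lambda0 b], the scalar [x = <K, b>] solves
    [x' = lambda0 x - <C, b>], whatever the control [C].  If [x >= 0] this gives
    the budget constraint [int_0^oo exp (- lambda0 t) <C, b> dt <= <k, b>].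
    Discounted marginal utility along the explicit control is a constant times
    [exp (- lambda0 t) b], so bounding the utility of [C] by its tangent at the
    explicit control and integrating turns the budget constraint into
    [J C <= v k], with equality at the explicit control.  The same tangent bound
    gives the maximizer of the Hamiltonian, hence the HJB equation.  The closed
    loop flow preserves the positive cone exactly when [M - F] is nonnegative
    off the diagonal; conversely, starting from the basis vector [e_j], the
    initial velocity of the [i]-th coordinate is [w_ij - f_ij]. *)

(** * Tangent bound for the utility *)

(** Everything passes through the scalar [s = <k, b>]. The constant [delta = (rho - lambda0 (1 -
    gamma)) / gamma] ties the parameters together: [alpha] is chosen so that [Phi(b) = alpha delta],
    which makes the feedback consume at rate [delta], that is [<F k, b> = delta <k, b>]. Hence
    [g = lambda0 - delta], and discounted utility along the explicit control decays like
    [exp (- delta t)]. The main obstacle is regularity. A control is only locally integrable, so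
    [<K, b>] satisfies an integral equation and the budget constraint calls for an integration by
    parts without pointwise derivatives. The substitute rests on the monotonicity of
    [exp (- lambda0 t)], hence on [lambda0 >= 0], which comes from testing the eigenvector equation
    against the constant vector. The origin lies in the cone but not in the half-space: the explicit
    control vanishes there and offers no tangent point, so it needs a limit argument of its own. *)

Section crra.
Context {R : realType}.
Implicit Types (gamma c y s r : R).

(** Strict concavity of [x ^ s / s] against its tangent at 1. Both signs of [s] are handled
    together: the derivative [x ^ (s - 1) - 1] of the difference is positive before 1 and negative
    after it. *)
Lemma powR_chord_lt s r : s < 1 -> s != 0 -> 0 < r -> r != 1 ->
  r `^ s / s < s^-1 + (r - 1).
Proof.
move=> s1 s0 r0 rn1.
pose f (x : R) := x `^ s / s - x.
have df (x : R) : 0 < x -> is_derive x 1 f (x `^ (s - 1) - 1).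
  move=> x0; rewrite /f.
  have h := @is_derive1_powR R s x x0.
  apply: is_derive_eq.
  by rewrite scaler0 add0r /GRing.scale/= mulKf.
have cf (a b : R) : 0 < a -> {within `[a, b], continuous f}.
  move=> a0; apply: derivable_within_continuous => x.
  rewrite in_itv/= => /andP[ax _].
  by apply: (@ex_derive _ _ _ _ _ _ _ (df x (lt_le_trans a0 ax))).
suff : f r < f 1.
  by rewrite /f powR1 mul1r; lra.
have [r1|r1|/eqP] := ltgtP r 1; last by rewrite (negbTE rn1).
- have [x| |c] := @MVT R f (fun x => x `^ (s - 1) - 1) r 1 r1.
  + by rewrite in_itv/= => /andP[rx _]; apply: df; apply: lt_trans rx.
  + exact: cf.
  + rewrite in_itv/= => /andP[rc c1 fE].
    have : 0 < c `^ (s - 1) - 1.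
      rewrite subr_gt0 /powR gt_eqF ?(lt_trans r0)// expR_gt1.
      by rewrite nmulr_rgt0 ?subr_lt0// ln_lt0// c1 (lt_trans r0).
    move=> h; have : 0 < f 1 - f r by rewrite fE mulr_gt0// subr_gt0.
    by rewrite subr_gt0.
- have [x| |c] := @MVT R f (fun x => x `^ (s - 1) - 1) 1 r r1.
  + by rewrite in_itv/= => /andP[rx _]; apply: df; apply: lt_trans rx.
  + exact: cf.
  + rewrite in_itv/= => /andP[c1 cr fE].
    have : c `^ (s - 1) - 1 < 0.
      rewrite subr_lt0 /powR gt_eqF ?(lt_trans ltr01)// expR_lt1.
      by rewrite nmulr_rlt0 ?subr_lt0// ln_gt0.
    move=> h; have : f r - f 1 < 0 by rewrite fE nmulr_rlt0// subr_gt0.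
    by rewrite subr_lt0.
Qed.

Lemma crraE gamma y : 0 < y -> crra gamma y = (y `^ (1 - gamma) / (1 - gamma))%:E.
Proof. by move=> y0; rewrite /crra (gt_eqF y0) andbF. Qed.

(** By homogeneity, dividing by [y] reduces this to [powR_chord_lt] with exponent [1 - gamma] at the
    ratio [c / y]. *)
Lemma crra_tangent_lt gamma y c : 0 < gamma -> gamma != 1 -> 0 < y -> 0 <= c ->
  c != y ->
  (crra gamma c <
   (y `^ (1 - gamma) / (1 - gamma) + y `^ (- gamma) * (c - y))%:E)%E.
Proof.
move=> g0 g1 y0 c0 cy.
have s0 : 1 - gamma != 0 by rewrite subr_eq0 eq_sym.
have yE : y `^ (- gamma) * y = y `^ (1 - gamma).
  rewrite -{2}(powRr1 (ltW y0)) -powRD ?(gt_eqF y0) ?implybT//.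
  by rewrite addrC.
have ys := powR_gt0 (1 - gamma) y0.
(* At [c = 0] the utility is [-oo] for [gamma > 1] and 0 for [gamma < 1]; in the second case the
   claim is [1 < 1 / (1 - gamma)]. *)
move: c0; rewrite le_eqVlt => /predU1P[<-|c0].
  rewrite /crra eqxx andbT; case: ifPn => [_|]; first exact: ltNyr.
  rewrite -leNgt le_eqVlt (negbTE g1)/= => g1'.
  rewrite lte_fin powR0// mul0r sub0r mulrN yE subr_gt0.
  by rewrite ltr_pdivlMr ?subr_gt0// gtr_pMr// ltrBlDr ltrDl.
rewrite crraE// lte_fin.
have r0 : 0 < c / y by rewrite divr_gt0.
have := @powR_chord_lt (1 - gamma) (c / y) _ s0 r0 _.
rewrite ltrBlDr ltrDl => /(_ g0).
have -> : c / y != 1 by rewrite -(inj_eq (mulIf (lt0r_neq0 y0))) mulfVK ?mul1r ?lt0r_neq0.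
move=> /(_ isT) h.
have {1}-> : c = y * (c / y) by rewrite mulrC divfK ?lt0r_neq0.
rewrite powRM ?(ltW y0) ?(ltW r0)// -mulrA.
have -> : y `^ (- gamma) * (c - y) = y `^ (1 - gamma) * (c / y - 1).
  by rewrite -yE -mulrA; congr (_ * _); rewrite mulrBr mulr1 mulrC divfK ?lt0r_neq0.
by rewrite -mulrDr ltr_pM2l.
Qed.

Lemma crra_tangent gamma y c : 0 < gamma -> gamma != 1 -> 0 < y -> 0 <= c ->
  (crra gamma c <=
   (y `^ (1 - gamma) / (1 - gamma) + y `^ (- gamma) * (c - y))%:E)%E.
Proof.
move=> g0 g1 y0 c0; have [->|cy] := eqVneq c y.
  by rewrite crraE// subrr mulr0 addr0.
exact/ltW/crra_tangent_lt.
Qed.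

End crra.

(** * Welfare, its tangent, and the maximizer of the Hamiltonian *)

Section welfare.
Context {R : realType} {n : nat}.
Variables (p : 'I_n -> R) (gamma : R).
Hypotheses (p_gt0 : forall i, 0 < p i) (gamma_gt0 : 0 < gamma)
  (gamma_neq1 : gamma != 1).
Implicit Types c y q : 'cV[R]_n.

Lemma welfareE y : pos_cone y ->
  welfare p gamma y = (\sum_i p i * (y i 0 `^ (1 - gamma) / (1 - gamma)))%:E.
Proof.
move=> y0; rewrite /welfare -sumEFin; apply: eq_bigr => i _.
by rewrite crraE ?EFinM//; exact: (y0 _).
Qed.

Definition welfare_tangent_term y c (i : 'I_n) :=
  p i * (y i 0 `^ (1 - gamma) / (1 - gamma)
         + y i 0 `^ (- gamma) * (c i 0 - y i 0)).

(** The gradient of the welfare at a positive [y]. The Hamiltonian is only evaluated at covectors of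
    this form, whose maximizer is [y] itself, so marginal utility never has to be inverted for a
    general covector. *)
Definition marginal_welfare y : 'cV[R]_n := \col_i (p i * y i 0 `^ (- gamma)).

Lemma sum_welfare_tangent y c : \sum_i welfare_tangent_term y c i =
  \sum_i p i * (y i 0 `^ (1 - gamma) / (1 - gamma))
  + dotv c (marginal_welfare y) - dotv y (marginal_welfare y).
Proof.
rewrite /dotv -big_split/= -sumrB; apply: eq_bigr => i _.
rewrite /welfare_tangent_term !mxE; ring.
Qed.

Lemma welfare_tangent y c : pos_cone y -> nneg_cone c ->
  (welfare p gamma c <=
   (\sum_i p i * (y i 0 `^ (1 - gamma) / (1 - gamma))
    + dotv c (marginal_welfare y) - dotv y (marginal_welfare y))%:E)%E.
Proof.
move=> y0 c0; rewrite -sum_welfare_tangent -sumEFin; apply: lee_sum => i _.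
rewrite EFinM lee_pmul2l ?lte_fin//.
exact: (crra_tangent gamma_gt0 gamma_neq1 (y0 _) (c0 _)).
Qed.

Lemma welfare_tangent_lt y c : pos_cone y -> nneg_cone c -> c != y ->
  (welfare p gamma c <
   (\sum_i p i * (y i 0 `^ (1 - gamma) / (1 - gamma))
    + dotv c (marginal_welfare y) - dotv y (marginal_welfare y))%:E)%E.
Proof.
move=> y0 c0 cy.
have [i ci] : exists i, c i 0 != y i 0.
  apply/not_existsP => h; move/eqP: cy; apply; apply/colP => i; by apply/eqP/negPn/negP/h.
rewrite -sum_welfare_tangent -sumEFin /welfare (bigD1 i)//= [ltRHS](bigD1 i)//=.
(* The other coordinates may contribute [-oo]. They are first replaced by their finite tangent
   terms, so that the strict inequality at [i] survives the addition. *)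
have le_rest : (\sum_(j < n | j != i) (p j)%:E * crra gamma (c j 0%R) <=
    \sum_(j < n | j != i) (welfare_tangent_term y c j)%:E)%E.
  apply: lee_sum => j _; rewrite EFinM lee_pmul2l ?lte_fin//.
  exact: (crra_tangent gamma_gt0 gamma_neq1 (y0 _) (c0 _)).
apply: (le_lt_trans (leeD2l _ le_rest)); rewrite sumEFin lteD2rE//.
rewrite EFinM lte_pmul2l ?lte_fin//.
exact: (crra_tangent_lt gamma_gt0 gamma_neq1 (y0 _) (c0 _)).
Qed.

Lemma hamiltonian_cv_marginalE y : pos_cone y ->
  hamiltonian_cv p gamma (marginal_welfare y) y =
  (\sum_i p i * (y i 0 `^ (1 - gamma) / (1 - gamma)) - dotv y (marginal_welfare y))%:E.
Proof. by move=> y0; rewrite /hamiltonian_cv welfareE// -EFinD addrC. Qed.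

(** The linear term of the Hamiltonian cancels the slope of the tangent at [y], which leaves a
    constant bound equal to the value at [y]. *)
Lemma hamiltonian_cv_marginal_lt y c : pos_cone y -> nneg_cone c -> c != y ->
  (hamiltonian_cv p gamma (marginal_welfare y) c <
   hamiltonian_cv p gamma (marginal_welfare y) y)%E.
Proof.
move=> y0 c0 cy; rewrite hamiltonian_cv_marginalE// /hamiltonian_cv.
apply: lt_le_trans (_ : ((- dotv c (marginal_welfare y))%:E + _ <= _)%E).
  by rewrite lteD2lE//; exact: welfare_tangent_lt cy.
by rewrite -EFinD lee_fin; lra.
Qed.

Lemma hamiltonian_marginalE y : pos_cone y ->
  hamiltonian p gamma (marginal_welfare y) = hamiltonian_cv p gamma (marginal_welfare y) y.
Proof.
move=> y0; apply/eqP; rewrite eq_le; apply/andP; split.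
  apply: ge_ereal_sup => _ [c c0 <-]; have [->//|cy] := eqVneq c y.
  exact/ltW/hamiltonian_cv_marginal_lt.
by apply: ereal_sup_ubound; exists y => // i; exact/ltW/(y0 _).
Qed.

Lemma attains_hamiltonian_marginal y c : pos_cone y ->
  attains_sup (@nneg_cone R n) (hamiltonian_cv p gamma (marginal_welfare y)) c <-> c = y.
Proof.
move=> y0; have h := hamiltonian_marginalE y0.
split=> [[c0 cE]|->]; last by split=> [i|]; [exact/ltW/(y0 _)|rewrite -h].
apply/eqP/negPn/negP => /(hamiltonian_cv_marginal_lt y0 c0).
by rewrite cE -h ltxx.
Qed.

End welfare.

(** * Linear flows *)

Section linear_flow.
Context {R : realType} {n : nat}.
Implicit Types (N : 'M[R]_n) (v : 'cV[R]_n) (i : 'I_n) (c t : R).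

(** Taylor coefficients of the [i]-th coordinate of [exp (t N) v]. Working coordinate by coordinate
    makes the scalar theory of power series applicable. *)
Definition lin_flow_coeff N v i : R^nat :=
  fun m => iter m (mulmx N) v i 0 / m`!%:R.

Definition lin_flow N v (t : R) : 'cV[R]_n :=
  \col_i limn (pseries (lin_flow_coeff N v i) t).

(** A crude geometric majorant, enough to compare the flow with a scalar exponential series. *)
Lemma iter_mulmx_bound N v m i :
  `|iter m (mulmx N) v i 0| <=
    (\sum_j `|v j 0|) * (\sum_j \sum_l `|N j l|) ^+ m.
Proof.
set A : R := \sum_j `|v j 0|; set B : R := \sum_j \sum_l `|N j l|.
have B0 : 0 <= B by do 2![apply: sumr_ge0 => ? _].
have A0 : 0 <= A by apply: sumr_ge0.
elim: m i => [|m IH] i /=.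
  by rewrite expr0 mulr1 /A (bigD1 i)//= lerDl sumr_ge0.
rewrite mxE; apply: (le_trans (ler_norm_sum _ _ _)).
have : \sum_l `|N i l| * (A * B ^+ m) <= A * B ^+ m.+1.
  rewrite -mulr_suml exprS mulrCA ler_wpM2l// ler_wpM2r ?exprn_ge0//.
  by rewrite /B [leRHS](bigD1 i)//= lerDl; by do 2![apply: sumr_ge0 => ? _].
apply: le_trans; apply: ler_sum => l _.
by rewrite normrM ler_wpM2l.
Qed.

Lemma is_cvg_lin_flow N v i t : cvgn (pseries (lin_flow_coeff N v i) t).
Proof.
apply: (@normed_cvg R R^o).
set A : R := \sum_j `|v j 0|; set B : R := \sum_j \sum_l `|N j l|.
have B0 : 0 <= B by do 2![apply: sumr_ge0 => ? _].
have A0 : 0 <= A by apply: sumr_ge0.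
apply: (@series_le_cvg _ _ (A *: exp_coeff (B * `|t|))) => [m|m|m|].
- exact: normr_ge0.
- by apply: mulr_ge0 => //; apply: exp_coeff_ge0; rewrite mulr_ge0.
- rewrite /= /lin_flow_coeff !normrM normrX /exp_coeff /=.
  rewrite -[leRHS]/(A * ((B * `|t|) ^+ m / m`!%:R)) exprMn.
  have -> : A * (B ^+ m * `|t| ^+ m / m`!%:R) = A * B ^+ m / m`!%:R * `|t| ^+ m.
    by rewrite -!mulrA; congr (_ * (_ * _)); rewrite mulrC.
  rewrite normfV [X in _ / X]ger0_norm// ler_wpM2r ?exprn_ge0//.
  by rewrite ler_wpM2r// iter_mulmx_bound.
- exact/is_cvg_seriesZ/is_cvg_series_exp_coeff.
Qed.

(** Differentiating termwise amounts to replacing [v] by [N *m v], so all derived series are again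
    flows and converge everywhere. *)
Lemma pseries_diffs_lin_flow N v i :
  pseries_diffs (lin_flow_coeff N v i) = lin_flow_coeff N (N *m v) i.
Proof.
apply/funext => m; rewrite /pseries_diffs /lin_flow_coeff -iterSr.
by rewrite factS natrM invfM mulrCA mulVKf.
Qed.

Lemma lin_flow_mulmx N v t : lin_flow N (N *m v) t = N *m lin_flow N v t.
Proof.
apply/colP => i; rewrite !mxE; under eq_bigr do rewrite mxE.
apply: cvg_lim => //.
have -> : pseries (lin_flow_coeff N (N *m v) i) t =
    (fun m => \sum_j N i j * pseries (lin_flow_coeff N v j) t m).
  apply/funext => m; rewrite /pseries /series/=.
  under [RHS]eq_bigr do rewrite mulr_sumr.
  rewrite exchange_big/=; apply: eq_bigr => k _.
  rewrite /lin_flow_coeff -iterSr/= mxE !mulr_suml; apply: eq_bigr => j _.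
  by rewrite !mulrA.
apply: cvg_big => [|j _]; first exact: add_continuous.
apply: (@cvgMl_tmp R _ \oo _ (pseries (lin_flow_coeff N v j) t)).
exact: is_cvg_lin_flow.
Qed.

Lemma lin_flow0 N v : lin_flow N v 0 = v.
Proof.
apply/colP => i; rewrite mxE; apply: lim_near_cst => //.
near=> m; rewrite -[m]prednK; last by near: m.
rewrite /pseries /series/= big_nat_recl//= big1 ?addr0.
  by rewrite expr0 mulr1 /lin_flow_coeff/= fact0 divr1.
by move=> k _; rewrite expr0n mulr0.
Unshelve. all: by end_near. Qed.

Lemma is_derive_lin_flow N v i t :
  is_derive t 1 (fun s => lin_flow N v s i 0) ((N *m lin_flow N v t) i 0).
Proof.
rewrite -lin_flow_mulmx mxE -pseries_diffs_lin_flow.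
under eq_fun do rewrite mxE.
(* Termwise differentiation asks for convergence at some point beyond [|t|]. *)
apply: (@pseries_snd_diffs _ _ (`|t| + 1)).
- exact: is_cvg_lin_flow.
- by rewrite pseries_diffs_lin_flow; exact: is_cvg_lin_flow.
- by rewrite !pseries_diffs_lin_flow; exact: is_cvg_lin_flow.
- by rewrite [ltRHS]ger0_norm ?addr_ge0// ltrDl.
Qed.

Lemma lin_flow_ge0 N v t : (forall i j, 0 <= N i j) -> nneg_cone v -> 0 <= t ->
  nneg_cone (lin_flow N v t).
Proof.
move=> N0 v0 t0 i; rewrite mxE; apply: limr_ge; first exact: is_cvg_lin_flow.
apply: nearW => m; apply: sumr_ge0 => k _.
rewrite mulr_ge0 ?exprn_ge0// divr_ge0//.
elim: k i => [|k IH] i /=; first exact: (v0 _).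
by rewrite mxE; apply: sumr_ge0 => j _; rewrite mulr_ge0.
Qed.

(* The factor [exp (- c t)] undoes the shift by [c%:M], which makes a matrix
   with nonnegative off-diagonal entries entrywise nonnegative for [c] large. *)
Definition lin_sol (c : R) N v (t : R) : 'cV[R]_n :=
  expR (- c * t) *: lin_flow (N + c%:M) v t.

Lemma lin_sol0 c N v : lin_sol c N v 0 = v.
Proof. by rewrite /lin_sol mulr0 expR0 scale1r lin_flow0. Qed.

Lemma is_derive_lin_sol c N v i t :
  is_derive t 1 (fun s => lin_sol c N v s i 0) ((N *m lin_sol c N v t) i 0).
Proof.
have h := is_derive_lin_flow (N + c%:M) v i t.
rewrite (_ : (fun _ => _) =
  (fun s => expR (- c * s)) * (fun s => lin_flow (N + c%:M) v s i 0)); last first.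
  by apply/funext => s; rewrite /lin_sol mxE.
have he : is_derive t 1 (fun s => expR (- c * s)) (expR (- c * t) * - c).
  apply: (@is_derive1_comp _ expR (fun s => - c * s)).
  apply: is_derive_eq; rewrite /GRing.scale/=; ring.
apply: is_derive_eq.
rewrite /lin_sol -scalemxAr mulmxDl mul_scalar_mx !mxE /GRing.scale/=.
ring.
Qed.

Lemma lin_sol_ge0 c N v t : (forall i j, 0 <= (N + c%:M) i j) -> nneg_cone v ->
  0 <= t -> nneg_cone (lin_sol c N v t).
Proof.
by move=> N0 v0 t0 i; rewrite mxE mulr_ge0 ?expR_ge0//; exact: (lin_flow_ge0 N0 v0 t0 _).
Qed.

End linear_flow.

(** * Difference quotients, adjoint pairing and uniqueness for linear equations *)

Section difference_quotient.
Context {R : realType} {V : normedModType R}.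
Implicit Types (f : R -> V) (t : R) (l : V).

Lemma is_derive1_quotient f t l : is_derive t (1 : R) f l <->
  (s - t)^-1 *: (f s - f t) @[s --> t^'] --> l.
Proof.
split=> [[fdv fl]|].
- have {}fl : h^-1 *: (f (h *: 1 + t) - f t) @[h --> 0^'] --> l.
    by rewrite -fl; exact: fdv.
  have sh : (s - t) @[s --> t^'] --> 0^'.
    move=> A [e /= e0 eA]; exists e => // s /= ste st; apply: eA => /=.
      by rewrite sub0r normrN distrC.
    by rewrite subr_eq0.
  have := cvg_comp _ _ sh fl; apply: cvg_trans; apply: near_eq_cvg.
  by near=> s; rewrite /= /GRing.scale/= mulr1 subrK.
- move=> fl.
  have sh : (h + t) @[h --> (0 : R)^'] --> t^'.
    move=> A [e /= e0 eA]; exists e => // s /= se s0; apply: eA => /=.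
      by rewrite opprD addrCA subrr addr0 -[- s]sub0r.
    by rewrite -subr_eq0 addrK.
  have fh : h^-1 *: (f (h *: 1 + t) - f t) @[h --> 0^'] --> l.
    have := cvg_comp _ _ sh fl; apply: cvg_trans; apply: near_eq_cvg.
    by near=> s; rewrite /= addrK /GRing.scale/= mulr1.
  apply: DeriveDef; first by apply/cvg_ex; exists l; exact: fh.
  by apply: cvg_lim => //; exact: fh.
Unshelve. all: by end_near. Qed.

End difference_quotient.

Section ode.
Context {R : realType} {n : nat}.
Implicit Types (N : 'M[R]_n) (k v : 'cV[R]_n) (i : 'I_n) (c t T : R)
  (K z : R -> 'cV[R]_n).

Lemma is_derive_cVP K t (l : 'cV[R]_n) :
  (forall i, is_derive t (1 : R) (fun s => K s i 0) (l i 0)) <->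
  is_derive t (1 : R) K l.
Proof.
split=> [dK|[dK <-] i].
- have h : derivable K t (1 : R).
    by apply/derivable_mxP => i j; rewrite ord1; exact: (ex_derive (is_derive := dK i)).
  apply: DeriveDef => //; rewrite derive_mx//; apply/matrixP => i j.
  by rewrite mxE ord1; exact: (derive_val (is_derive := dK i)).
- apply: DeriveDef; first by move/derivable_mxP : dK; exact.
  by rewrite derive_mx// mxE.
Qed.

Lemma derive_linear_ode_solution N K :
  (forall t i, is_derive t (1 : R) (fun s => K s i 0) ((N *m K t) i 0)) ->
  linear_ode_solution N (K 0) K.
Proof.
move=> dK; split=> // t t0.
have /is_derive_cVP/is_derive1_quotient := dK t.
apply: cvg_trans; apply: cvg_app; exact: cvg_within.
Qed.

Lemma linear_ode_solution_derive N k K t i : linear_ode_solution N k K ->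
  0 < t -> is_derive t (1 : R) (fun s => K s i 0) ((N *m K t) i 0).
Proof.
move=> [_ dK] t0; move: i; apply/is_derive_cVP/is_derive1_quotient.
have := dK t (ltW t0); apply: cvg_trans; apply: cvg_app => A hA.
(* Since [t > 0], the restriction to [s >= 0] is void near [t], and the relative derivative is a
   two-sided one. *)
have h : \forall s \near t^', 0 <= s.
  by apply: cvg_within; near=> s; apply: ltW; near: s; exact: lt_nbhsr.
by apply: filterS2 h hA => s s0; apply.
Unshelve. all: by end_near. Qed.

(** At 0 only a one-sided derivative is given. Writing [K s = K 0 + s q(s)] with [q] convergent
    still yields the right continuity that the mean value theorem on [[0, T]] needs. *)
Lemma linear_ode_solution_cvg0 N k K i : linear_ode_solution N k K ->
  K s i 0 @[s --> 0^'+] --> K 0 i 0.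
Proof.
move=> [_ /(_ 0 (lexx 0)) dK].
have q : (s - 0)^-1 *: (K s - K 0) @[s --> 0^'+] --> N *m K 0.
  apply: cvg_trans dK; apply: cvg_app => A [e /= e0 eA].
  exists e => //= s se s0; apply: eA => //=; first by rewrite gt_eqF.
  exact: ltW.
have q' : s * ((s - 0)^-1 *: (K s - K 0)) i 0 + K 0 i 0 @[s --> 0^'+] -->
    0 * (N *m K 0) i 0 + K 0 i 0.
  apply: cvgD; last exact: cvg_cst.
  apply: cvgM; first by apply: cvg_at_right_filter; exact: cvg_id.
  exact: (cvg_comp _ _ q (@coord_continuous _ _ _ i 0 (N *m K 0))).
move: q'; rewrite mul0r add0r; apply: cvg_trans; apply: near_eq_cvg.
near=> s; rewrite /= !mxE subr0 mulVKf ?subrK//.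
Unshelve. all: by end_near. Qed.

Lemma derive0_constant (f : R -> R) (a b : R) : a < b ->
  (forall s, s \in `]a, b[ -> is_derive s (1 : R) f 0) ->
  {within `[a, b], continuous f} -> f b = f a.
Proof.
move=> ab df cf; have [c _ ] := MVT ab df cf.
by rewrite mul0r => /eqP; rewrite subr_eq0 => /eqP.
Qed.

(* [z] solves the adjoint equation, hence [<K, z>] is constant. *)
Lemma linear_ode_pairing N k K z T : linear_ode_solution N k K -> 0 <= T ->
  (forall t i, is_derive t (1 : R) (fun s => z s i 0) (- (N^T *m z t) i 0)) ->
  dotv (K T) (z T) = dotv k (z 0).
Proof.
move=> Ksol; rewrite le_eqVlt => /predU1P[<- _|T0 dz].
  by case: Ksol => ->.
have -> : k = K 0 by case: Ksol.
pose f := \sum_(i < n) ((fun s => K s i 0) * (fun s => z s i 0)).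
have fE : f = (fun s => dotv (K s) (z s)) by rewrite /f fct_sumE.
suff : f T = f 0 by rewrite fE.
 apply: derive0_constant => //.
- move=> s; rewrite in_itv/= => /andP[s0 _].
  have dK i := linear_ode_solution_derive i Ksol s0.
  have dzs i := dz s i.
  apply: is_derive_eq.
  rewrite /GRing.scale/= big_split/=.
  under eq_bigr do rewrite mulrN.
  rewrite sumrN addrC; apply/eqP; rewrite subr_eq0; apply/eqP.
  under eq_bigr do rewrite mxE mulr_sumr.
  rewrite exchange_big/=; apply: eq_bigr => i _.
  rewrite mxE mulr_sumr; apply: eq_bigr => j _; rewrite mxE; ring.
- apply/(continuous_within_itvP _ T0).
  have cz i s : {for s, continuous (fun s => z s i 0)}.
    apply/differentiable_continuous/derivable1_diffP.
    exact: (ex_derive (is_derive := dz s i)).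
  have cK s : 0 < s -> forall i, {for s, continuous (fun s => K s i 0)}.
    move=> s0 i; apply/differentiable_continuous/derivable1_diffP.
    exact: (ex_derive (is_derive := linear_ode_solution_derive i Ksol s0)).
  have cf s : 0 < s -> {for s, continuous f}.
    move=> s0; rewrite fE.
    apply: cvg_big => [|i _]; first exact: add_continuous.
    by apply: cvgM; [exact: cK|exact: cz].
  split.
  + by move=> s; rewrite in_itv/= => /andP[s0 _]; exact: cf.
  + rewrite fE.
    apply: cvg_big => [|i _]; first exact: add_continuous.
    apply: cvgM; first exact: linear_ode_solution_cvg0 Ksol.
    by apply: cvg_at_right_filter; exact: cz.
  + by apply: cvg_at_left_filter; exact: cf.
Qed.

(** Uniqueness by duality: the adjoint flow run backwards from the [i]-th basis vector at time [T]
    pairs with any solution to give its [i]-th coordinate at [T], and this pairing is already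
    determined at time 0 by [k]. *)
Lemma linear_ode_solution_unique N k K K' T : linear_ode_solution N k K ->
  linear_ode_solution N k K' -> 0 <= T -> K T = K' T.
Proof.
move=> hK hK' T0; apply/colP => i.
pose z (s : R) := lin_flow N^T (delta_mx i 0 : 'cV[R]_n) (T - s).
have dz t j : is_derive t (1 : R) (fun s => z s j 0) (- (N^T *m z t) j 0).
  have h := is_derive_lin_flow N^T (delta_mx i 0) j (T - t).
  have hs : is_derive t (1 : R) (fun s => T - s) (- 1).
    by apply: is_derive_eq; ring.
  rewrite -[- _]mulr1 mulNr -mulrN.
  exact: (@is_derive1_comp _ _ (fun s => T - s) t _ _ h hs).
have dotE (x : 'cV[R]_n) : dotv x (z T) = x i 0.
  rewrite /z subrr lin_flow0 /dotv (bigD1 i)//= big1 ?addr0 => [|j ji].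
    by rewrite mxE !eqxx mulr1.
  by rewrite mxE (negbTE ji) mulr0.
by rewrite -!dotE (linear_ode_pairing hK T0 dz) (linear_ode_pairing hK' T0 dz).
Qed.

(** Here the adjoint solution to pair with is [exp (- g s) b]. *)
Lemma linear_ode_solution_exp N k K (b : 'cV[R]_n) g T :
  linear_ode_solution N k K -> N^T *m b = g *: b -> 0 <= T ->
  dotv (K T) b = dotv k b * expR (g * T).
Proof.
move=> hK Nb T0.
pose z (s : R) := expR (- g * s) *: b.
have dz t j : is_derive t (1 : R) (fun s => z s j 0) (- (N^T *m z t) j 0).
  rewrite /z -scalemxAr Nb !mxE; under eq_fun do rewrite mxE.
  have he : is_derive t 1 (fun s => expR (- g * s)) (expR (- g * t) * - g).
    apply: (@is_derive1_comp _ expR (fun s => - g * s)).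
    apply: is_derive_eq; rewrite /GRing.scale/=; ring.
  apply: is_derive_eq; rewrite /GRing.scale/=; ring.
have dotZ (x : 'cV[R]_n) (r : R) : dotv x (r *: b) = r * dotv x b.
  by rewrite /dotv mulr_sumr; apply: eq_bigr => i _; rewrite mxE mulrCA.
have := linear_ode_pairing hK T0 dz; rewrite /z !dotZ mulr0 expR0 mul1r => <-.
by rewrite mulNr expRN mulrAC mulVf ?mul1r// expR_eq0.
Qed.

End ode.

(** * The budget constraint *)

Section budget.
Context {R : realType}.
Local Notation mu := (@lebesgue_measure R).
Local Notation primitive y t := (parameterized_integral mu 0 t y).
Implicit Types (x y : R -> R) (l a b s t T : R).

Lemma integrable_mul_expR l y T :
  mu.-integrable `[0, T] (EFin \o y) ->
  mu.-integrable `[0, T] (EFin \o (fun s => expR (- l * s) * y s)).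
Proof.
move=> iy; rewrite (_ : _ \o _ = (EFin \o (fun s => expR (- l * s))) \* (EFin \o y))%E//.
apply: integrableMr => //.
  apply: measurable_funTS; apply: continuous_measurable_fun => s.
  apply: (continuous_comp (g := expR)); last exact: continuous_expR.
  by apply: cvgMl_tmp; exact: cvg_id.
exists (expR (`|l| * T)); split; first exact: num_real.
move=> M lM s /=; rewrite in_itv/= => /andP[s0 sT].
rewrite ger0_norm ?expR_ge0//; apply: le_trans (ltW lM).
rewrite ler_expR (le_trans (ler_norm _))// normrM normrN (ger0_norm s0).
exact: ler_wpM2l.
Qed.

Lemma le_primitive y a b :
  (forall s, 0 <= s -> 0 <= y s) ->
  (forall T, 0 <= T -> mu.-integrable `[0, T] (EFin \o y)) ->
  0 <= a -> a <= b -> primitive y a <= primitive y b.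
Proof.
move=> y0 iy a0 ab; rewrite -subr_ge0 /parameterized_integral.
rewrite Rintegral_itvB ?bnd_simp//; last by apply: iy; exact: le_trans ab.
apply: Rintegral_ge0 => s /=; rewrite in_itv/= => /andP[as_ _].
by apply: y0; apply: le_trans (ltW as_).
Qed.

(** For [l >= 0] the weight decreases, so on []a, b]] it stays between its end values; [y >= 0]
    preserves the order under the integral. *)
Lemma expR_weighted_bounds l y a b : 0 <= l ->
  (forall s, 0 <= s -> 0 <= y s) ->
  (forall T, 0 <= T -> mu.-integrable `[0, T] (EFin \o y)) ->
  0 <= a -> a <= b ->
  let Z t := primitive (fun s => expR (- l * s) * y s) t in
  expR (- l * b) * (primitive y b - primitive y a) <= Z b - Z a /\
  Z b - Z a <= expR (- l * a) * (primitive y b - primitive y a).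
Proof.
move=> l0 y0 iy a0 ab Z.
have b0 := le_trans a0 ab.
have sub : `]a, b] `<=` `[0, b].
  move=> s /=; rewrite !in_itv/= => /andP[as_ ->]; rewrite andbT.
  exact: le_trans (ltW as_).
have iyab : mu.-integrable `]a, b] (EFin \o y).
  by apply: integrableS (iy b b0).
have iZ := integrable_mul_expR l (iy b b0).
have iZab : mu.-integrable `]a, b] (EFin \o (fun s => expR (- l * s) * y s)).
  by apply: integrableS iZ.
have YE : primitive y b - primitive y a = \int[mu]_(s in `]a, b]) y s.
  by apply: Rintegral_itvB; rewrite ?bnd_simp//; exact: iy.
have ZE : Z b - Z a = \int[mu]_(s in `]a, b]) (expR (- l * s) * y s).
  by apply: Rintegral_itvB; rewrite ?bnd_simp//.
have icst (r : R) : mu.-integrable `]a, b] (EFin \o (fun s => r * y s)).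
  rewrite (_ : _ \o _ = (fun s => r%:E * (y s)%:E)%E)//.
  exact: integrableZl.
rewrite YE ZE -!RintegralZl//; split;
  apply: le_Rintegral => // s /=; rewrite in_itv/= => /andP[as_ sb];
  (apply: ler_wpM2r; first by apply: y0; apply: (le_trans a0); exact: ltW);
  by rewrite ler_expR !mulNr lerN2 ler_wpM2l// ltW.
Qed.

(* With [f t = exp (- l t)], [Y] the primitive of [y] and [Z] that of [f y],
   the monotonicity of [f] and [Y] squeezes every increment of [Z - f Y]
   between those of [- f], weighted by the end values of [Y]: this replaces a
   Lebesgue integration by parts. *)
Lemma is_derive_weighted_primitive l y t : 0 <= l ->
  (forall s, 0 <= s -> 0 <= y s) ->
  (forall T, 0 <= T -> mu.-integrable `[0, T] (EFin \o y)) ->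
  0 < t ->
  is_derive t (1 : R)
    (fun s => primitive (fun s => expR (- l * s) * y s) s
              - expR (- l * s) * primitive y s)
    (l * expR (- l * t) * primitive y t).
Proof.
move=> l0 y0 iy t0.
set Z := fun s => primitive (fun s => expR (- l * s) * y s) s.
set Y := fun s => primitive y s.
set f := fun s : R => expR (- l * s).
pose N s := Z s - f s * Y s.
rewrite -[X in is_derive _ _ X _]/N.
have df : is_derive t (1 : R) f (expR (- l * t) * - l).
  apply: (@is_derive1_comp _ expR (fun s => - l * s)).
  apply: is_derive_eq; rewrite /GRing.scale/=; ring.
have /is_derive1_quotient := df.
set q := (fun s => _ *: _) => qf.
apply/is_derive1_quotient.
have cY : {for t, continuous Y}.
  have tt : t \in `]0, t + 1[ by rewrite in_itv/= t0 ltrDl ltr01.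
  have t10 : 0 < t + 1 by rewrite addr_gt0.
  apply: (within_continuous_continuous t10 _ tt).
  exact: (parameterized_integral_continuous (ltW t10) (iy _ (ltW t10))).
(* The error is a product of two increments, so after division by [s - t] it vanishes as soon as [f]
   is differentiable and [Y] merely continuous at [t]; [Y] itself need not be differentiable
   there. *)
have key s : 0 <= s ->
    `|N s - N t + (f s - f t) * Y t| <= `|f s - f t| * `|Y s - Y t|.
  move=> s0; rewrite -normrM.
  have f_decr u v : u <= v -> f v <= f u.
    by move=> uv; rewrite ler_expR !mulNr lerN2 ler_wpM2l.
  have [st|ts] := leP s t.
    have [h1 h2] : f t * (Y t - Y s) <= Z t - Z s /\
        Z t - Z s <= f s * (Y t - Y s) by exact: expR_weighted_bounds.
    have h3 : Y s <= Y t := le_primitive y0 iy s0 st.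
    have h4 := f_decr _ _ st.
    rewrite [leRHS]ler0_norm; last by rewrite mulr_ge0_le0// ?subr_ge0// subr_le0.
    have h5 : 0 <= (f s - f t) * (Y t - Y s) by rewrite mulr_ge0// subr_ge0.
    by rewrite /N ler_norml; apply/andP; split; lra.
  have [h1 h2] : f s * (Y s - Y t) <= Z s - Z t /\
      Z s - Z t <= f t * (Y s - Y t).
    by apply: expR_weighted_bounds => //; exact: ltW.
  have h3 : Y t <= Y s := le_primitive y0 iy (ltW t0) (ltW ts).
  have h4 := f_decr _ _ (ltW ts).
  rewrite [leRHS]ler0_norm; last by rewrite mulr_le0_ge0// ?subr_ge0// subr_le0.
  have h5 : 0 <= (f t - f s) * (Y s - Y t) by rewrite mulr_ge0// subr_ge0.
  by rewrite /N ler_norml; apply/andP; split; lra.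
have cYt : Y s @[s --> t^'] --> Y t by apply: cvg_within_filter; exact: cY.
have h0 : `|q s| * `|Y s - Y t| @[s --> t^'] --> (0 : R).
  rewrite -[0](mulr0 `|expR (- l * t) * - l|).
  apply: cvgM; first exact: cvg_norm qf.
  have := cvg_norm (cvgB cYt (cvg_cst (Y t))).
  by rewrite subrr normr0; apply.
have h1 : (s - t)^-1 *: (N s - N t) + q s * Y t @[s --> t^'] --> (0 : R).
  have h0' : - (`|q s| * `|Y s - Y t|) @[s --> t^'] --> (0 : R).
    by rewrite -oppr0; exact: cvgN.
  apply: (squeeze_cvgr _ h0' h0); near=> s.
  rewrite -ler_norml -normrM.
  have -> : (s - t)^-1 *: (N s - N t) + q s * Y t =
      (s - t)^-1 * (N s - N t + (f s - f t) * Y t).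
    by rewrite /q /GRing.scale/=; ring.
  rewrite /q /GRing.scale/= !normrM -mulrA ler_wpM2l// key//.
  by apply: ltW; near: s; apply: cvg_within; exact: lt_nbhsr.
have h2 : q s * Y t @[s --> t^'] --> expR (- l * t) * - l * Y t.
  by apply: cvgM => //; exact: cvg_cst.
rewrite -/(Y t).
have -> : l * expR (- l * t) * Y t = 0 - expR (- l * t) * - l * Y t by ring.
apply: (cvg_trans _ (cvgB h1 h2)); apply: near_eq_cvg; near=> s.
by rewrite /= -[LHS]/(_ + _ - _) addrK.
Unshelve. all: by end_near. Qed.

Lemma is_derive_primitive x s : {within `[0, +oo[, continuous x} -> 0 < s ->
  is_derive s (1 : R) (fun t => primitive x t) (x s).
Proof.
move=> cx s0; have s1 : s < s + 1 by rewrite ltrDl.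
have ix : mu.-integrable `[0, s + 1] (EFin \o x).
  apply: continuous_compact_integrable; first exact: segment_compact.
  by apply: continuous_subspaceW cx => t /=; rewrite !in_itv/= andbT => /andP[].
have cxs : {for s, continuous x}.
  have [+ _] := (continuous_within_itvcyP 0 x).1 cx; apply.
  by rewrite in_itv/= s0.
have [h1 h2] := continuous_FTC1_closed s1 ix s0 cxs.
by apply: DeriveDef; [exact: h1|rewrite -derive1E; exact: h2].
Qed.

(** Variation of constants: [Z + exp (- l s) x] keeps its initial value [x0]. *)
Lemma weighted_budget l x y (x0 : R) T : 0 <= l ->
  {within `[0, +oo[, continuous x} ->
  (forall s, 0 <= s -> 0 <= y s) ->
  (forall T, 0 <= T -> mu.-integrable `[0, T] (EFin \o y)) ->
  (forall t, 0 <= t ->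
     x t = x0 + \int[mu]_(s in `[0, t]) (l * x s - y s)) ->
  0 <= T ->
  primitive (fun s => expR (- l * s) * y s) T = x0 - expR (- l * T) * x T.
Proof.
move=> l0 cx y0 iy xE; rewrite le_eqVlt => /predU1P[<-|T0].
  rewrite /parameterized_integral set_itv1 Rintegral_set1 mulr0 expR0 mul1r.
  by rewrite xE// set_itv1 Rintegral_set1 addr0 subrr.
have cxT (t : R) : 0 <= t -> {within `[0, t], continuous x}.
  move=> t0; apply: continuous_subspaceW cx => s /=.
  by rewrite !in_itv/= andbT => /andP[].
have ix (t : R) : 0 <= t -> mu.-integrable `[0, t] (EFin \o x).
  move=> t0; apply: continuous_compact_integrable; last exact: cxT.
  exact: segment_compact.
have {}xE t : 0 <= t -> x t = x0 + (l * primitive x t - primitive y t).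
  move=> t0; rewrite xE// RintegralB ?RintegralZl//; [exact: ix| |exact: iy].
  rewrite (_ : _ \o _ = (fun s => l%:E * (x s)%:E)%E)//.
  by apply: integrableZl => //; exact: ix.
pose Z s := primitive (fun s => expR (- l * s) * y s) s.
pose N s := Z s - expR (- l * s) * primitive y s.
pose f (s : R) := expR (- l * s).
pose P s := x0 + l * primitive x s.
(* Neither [Z] nor [x] need be differentiable. Inserting the integral equation for [x] regroups
   their combination into [N] and [f * P], which are differentiable at every positive time. *)
pose D : R -> R := N + f * P.
have DE (s : R) : 0 <= s -> D s = Z s + expR (- l * s) * x s.
  by move=> s0; rewrite xE// -[D s]/(N s + f s * P s) /N /f /P; ring.
suff : D T = D 0.
  rewrite !DE ?(ltW T0)// {2}/Z /parameterized_integral set_itv1 Rintegral_set1.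
  rewrite mulr0 expR0 mul1r (xE 0)// /parameterized_integral set_itv1 !Rintegral_set1.
  by rewrite mulr0 subrr addr0 add0r /Z => <-; rewrite addrK.
have dD (s : R) : 0 < s -> is_derive s (1 : R) D 0.
  move=> s0; have dN : is_derive s (1 : R) N (l * expR (- l * s) * primitive y s).
    exact: is_derive_weighted_primitive.
  have df : is_derive s (1 : R) f (expR (- l * s) * - l).
    apply: (@is_derive1_comp _ expR (fun s => - l * s)).
    apply: is_derive_eq; rewrite /GRing.scale/=; ring.
  have dx : is_derive s (1 : R) (fun s => primitive x s) (x s).
    exact: is_derive_primitive.
  have dP : is_derive s (1 : R) P (l * x s).
    have := is_deriveD (is_derive_cst x0 s 1) (is_deriveZ l dx).
    by rewrite add0r.
  have := is_deriveD dN (is_deriveM df dP).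
  suff -> : l * expR (- l * s) * primitive y s +
    (f s *: (l * x s) + P s *: (expR (- l * s) * - l)) = 0 by [].
  rewrite (xE s (ltW s0)) /f /P /GRing.scale/=; ring.
have cD0 : D s @[s --> 0^'+] --> D 0.
  have cp y' : (forall t, 0 <= t -> mu.-integrable `[0, t] (EFin \o y')) ->
      primitive y' s @[s --> 0^'+] --> primitive y' 0.
    move=> /(_ T (ltW T0)) /(parameterized_integral_continuous (ltW T0)).
    by move=> /(continuous_within_itvP _ T0)[].
  have cf : f s @[s --> 0^'+] --> f 0.
    apply: cvg_at_right_filter.
    apply: (continuous_comp (g := expR)); last exact: continuous_expR.
    by apply: cvgMl_tmp; exact: cvg_id.
  apply: cvgD.
    apply: cvgB; first by apply: cp => t t0; exact/integrable_mul_expR/iy.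
    by apply: cvgM => //; exact: cp.
  apply: cvgM => //; apply: cvgD; first exact: cvg_cst.
  by apply: cvgMl_tmp; exact: cp.
clearbody D; apply: (derive0_constant T0).
  by move=> s; rewrite in_itv/= => /andP[s0 _]; exact: dD.
have cD (s : R) : 0 < s -> {for s, continuous D}.
  move=> s0; apply/differentiable_continuous/derivable1_diffP.
  exact: (ex_derive (is_derive := dD s s0)).
apply/(continuous_within_itvP _ T0); split=> //.
  by move=> s; rewrite in_itv/= => /andP[s0 _]; exact: cD.
by apply: cvg_at_left_filter; exact: cD.
Qed.

End budget.

(** * Integrals over the half-line *)

Section improper_integral.
Context {R : realType}.
Local Notation mu := (@lebesgue_measure R).
Implicit Types (h : R -> R) (f : R -> \bar R).

Lemma measurable_fun_itv0y h :
  (forall T : R, 0 <= T -> measurable_fun (`[0, T] : set R) h) ->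
  measurable_fun (`[0, +oo[ : set R) h.
Proof.
move=> mh; rewrite itv_bndy_bigcup_BRight.
apply/measurable_fun_bigcup => i; first exact: measurable_itv.
by rewrite add0r; exact: mh.
Qed.

(** Monotone convergence along the intervals [[0, i]]. *)
Lemma ge0_improper_integral_le h (c : R) : (forall t, 0 <= t -> 0 <= h t) ->
  (forall T : R, 0 <= T -> mu.-integrable `[0, T] (EFin \o h)) ->
  (forall T : R, 0 <= T -> parameterized_integral mu 0 T h <= c) ->
  mu.-integrable `[0, +oo[ (EFin \o h) /\
  (\int[mu]_(t in `[0%R, +oo[) (h t)%:E <= c%:E)%E.
Proof.
move=> h0 ih hc.
have mh : measurable_fun (`[0, +oo[ : set R) h.
  apply: measurable_fun_itv0y => T T0.
  by apply/measurable_EFinP; exact: (measurable_int mu (ih T T0)).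
have le_c : (\int[mu]_(t in `[0%R, +oo[) (h t)%:E <= c%:E)%E.
  rewrite itv_bndy_bigcup_BRight.
  have h0' i x : `[0, 0 + i%:R]%classic x -> (0 <= (h x)%:E)%E.
    by rewrite /= in_itv/= lee_fin => /andP[x0 _]; exact: h0.
  have ndF : nondecreasing_seq (fun i => `[0, 0 + i%:R]%classic : set R).
    move=> i j ij; apply/subsetPset => x /=; rewrite !in_itv/= => /andP[-> xi].
    by rewrite (le_trans xi)// lerD2l ler_nat.
  have cv : (\int[mu]_(x in `[0%R, (0 + i%:R)%R]) (h x)%:E @[i --> \oo] -->
      \int[mu]_(x in (\bigcup_i `[0%R, (0 + i%:R)%R])%classic) (h x)%:E)%E.
    apply: ge0_nondecreasing_set_cvg_integral => // i.
    by rewrite add0r; exact: (measurable_int mu (ih _ (ler0n _ _))).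
  rewrite -(cvg_lim _ cv)//.
  apply: lime_le; first by apply/cvg_ex; eexists; exact: cv.
  apply: nearW => i; rewrite add0r.
    have := hc i%:R (ler0n _ _); rewrite /parameterized_integral /Rintegral -lee_fin fineK//.
    by apply: integrable_fin_num => //; exact: ih.
split=> //; apply/integrableP; split; first exact/measurable_EFinP.
apply: le_lt_trans (ltry c); apply: le_trans le_c; rewrite le_eqVlt.
apply/orP; left; apply/eqP; apply: eq_integral => t; rewrite inE/= in_itv/= andbT => t0.
by rewrite ger0_norm// h0.
Qed.

(** The integrand is the density of the exponential law of rate [r], whose total mass is 1. *)
Lemma improper_exp_integral (r : R) : 0 < r ->
  mu.-integrable `[0, +oo[ (EFin \o (fun t => r * expR (- r * t))) /\
  (\int[mu]_(t in `[0%R, +oo[) (r * expR (- r * t))%:E = 1)%E.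
Proof.
move=> r0; split.
  have := integrable_exponential_pdf r0.
  rewrite /exponential_pdf -restrict_EFin => /integrable_restrict.
  by rewrite setTI; apply.
rewrite -(integral_exponential_pdf r0) integral_mkcond.
by apply: eq_integral => t _; rewrite /exponential_pdf !patchE; case: ifP.
Qed.

(** The payoff integrand may take the value [-oo] or fail to be integrable; comparing positive and
    negative parts separately asks for integrability of the upper bound only. *)
Lemma le_integral_integrable (D : set R) f h : measurable D ->
  measurable_fun D f -> mu.-integrable D (EFin \o h) ->
  (forall t, D t -> (f t <= (h t)%:E)%E) ->
  (\int[mu]_(t in D) f t <= \int[mu]_(t in D) (h t)%:E)%E.
Proof.
move=> mD mf ih fh; have mh := measurable_int mu ih.
rewrite integralE [leRHS]integralE; apply: leeB; apply: ge0_le_integral => //.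
- exact: measurable_funepos.
- exact: measurable_funepos.
- by move=> t Dt; rewrite /= !funeposE ge_max !le_max lexx orbT (fh t Dt) orTb.
- exact: measurable_funeneg.
- exact: measurable_funeneg.
- move=> t Dt; rewrite /= !funenegE ge_max !le_max lexx orbT andbT.
  by rewrite leeN2 (fh t Dt).
Qed.

Lemma measurable_crra (gamma : R) : measurable_fun [set: R] (crra gamma).
Proof.
rewrite /crra; case: (1 < gamma) => /=.
  apply: measurable_fun_ifT => //; first exact: measurable_fun_eqr.
  apply/measurable_EFinP; exact: measurable_funM.
apply/measurable_EFinP; exact: measurable_funM.
Qed.

Lemma measurable_discounted_welfare n (p : 'I_n -> R) (gamma rho : R)
    (C : R -> 'cV[R]_n) : control C ->
  measurable_fun (`[0, +oo[ : set R)
    (fun t => (expR (- (rho * t)))%:E * welfare p gamma (C t))%E.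
Proof.
move=> [_ iC]; apply: emeasurable_funM.
  apply/measurable_EFinP; apply: (measurableT_comp (@measurable_expR R)).
  by apply: measurable_funTS; apply: measurableT_comp => //; exact: measurable_funM.
apply: emeasurable_sum => i; apply: emeasurable_funM => //.
apply: (measurableT_comp (measurable_crra gamma)).
apply: measurable_fun_itv0y => T T0.
by apply/measurable_EFinP; exact: (measurable_int mu (iC i T T0)).
Qed.

End improper_integral.

(** * The explicit value function *)

Section dotv.
Context {R : realType} {n : nat}.
Implicit Types (x y b k : 'cV[R]_n) (r : R).

Lemma dotvC x y : dotv x y = dotv y x.
Proof. by apply: eq_bigr => i _; rewrite mulrC. Qed.

Lemma dotvZr r x y : dotv x (r *: y) = r * dotv x y.
Proof. by rewrite /dotv mulr_sumr; apply: eq_bigr => i _; rewrite mxE mulrCA. Qed.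

Lemma dotv_linear b : linear (fun x => dotv x b : R^o).
Proof.
move=> r x y; rewrite /dotv scaler_sumr -big_split/=; apply: eq_bigr => i _.
by rewrite !mxE mulrDl -mulrA.
Qed.

Lemma dotv_delta b i : dotv (delta_mx i 0) b = b i 0.
Proof.
rewrite /dotv (bigD1 i)//= big1 ?addr0 => [|j ji]; first by rewrite mxE !eqxx mul1r.
by rewrite mxE (negbTE ji) mul0r.
Qed.

Lemma dotv_mulmx (M : 'M[R]_n) x y : dotv (M *m x) y = dotv x (M^T *m y).
Proof.
rewrite /dotv; under eq_bigr do rewrite mxE mulr_suml.
rewrite exchange_big/=; apply: eq_bigr => i _; rewrite mxE mulr_sumr.
by apply: eq_bigr => j _; rewrite mxE; ring.
Qed.

Lemma dotv_ge0 x b : nneg_cone x -> pos_cone b -> 0 <= dotv x b.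
Proof.
by move=> x0 b0; apply: sumr_ge0 => i _; exact: (mulr_ge0 (x0 i) (ltW (b0 i))).
Qed.

Lemma dotv_gt0 x b : nneg_cone x -> x != 0 -> pos_cone b -> 0 < dotv x b.
Proof.
move=> x0 xn0 b0; rewrite lt_neqAle eq_sym dotv_ge0// andbT.
apply: contra xn0; rewrite psumr_eq0 => [/allP h|i _]; last first.
  exact: (mulr_ge0 (x0 i) (ltW (b0 i))).
apply/eqP/colP => i; rewrite mxE; apply/eqP.
by have := h i (mem_index_enum _); rewrite mulf_eq0 (gt_eqF (b0 i)) orbF.
Qed.

Lemma continuous_dotv b : continuous (fun x => dotv x b).
Proof.
move=> x; apply: (cvg_big _ (nbhs_filter x)) => [|i _]; first exact: add_continuous.
have := @cvgM R _ (nbhs x) _ (fun y : 'cV[R]_n => y i 0) (cst (b i 0)).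
by apply; [exact: coord_continuous|exact: cvg_cst].
Qed.

Lemma open_half_space b : open (half_space b).
Proof.
rewrite (_ : half_space b = (fun x => dotv x b) @^-1` [set r | 0 < r])//.
by apply: open_comp; [move=> x _; exact: continuous_dotv|exact: open_gt].
Qed.

End dotv.

Section explicit_value.
Context {R : realType} {n : nat}.
Variables (gamma alpha : R) (b : 'cV[R]_n).
Hypothesis gamma_neq1 : gamma != 1.
Implicit Types k : 'cV[R]_n.

Lemma differentiable_explicit_value k : half_space b k ->
  differentiable (explicit_value gamma alpha b) k /\
  grad (explicit_value gamma alpha b) k =
    (alpha `^ gamma * dotv k b `^ (- gamma)) *: b.
Proof.
rewrite /half_space/= => k0.
have s0 : 1 - gamma != 0 by rewrite subr_eq0 eq_sym.
pose phi (s : R) : R := alpha `^ gamma / (1 - gamma) * s `^ (1 - gamma).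
pose lM := GRing.isLinear.Build _ _ _ _ _ (dotv_linear b).
pose ell : {linear 'cV[R]_n -> R^o} := HB.pack (fun x => dotv x b : R^o) lM.
have cell : continuous ell by exact: continuous_dotv.
have dphi : is_derive (ell k) (1 : R) phi (alpha `^ gamma * dotv k b `^ (- gamma)).
  have h := @is_derive1_powR R (1 - gamma) (ell k) k0.
  apply: is_derive_eq; rewrite /GRing.scale/= mulrA mulfVK//.
  by rewrite addrAC subrr sub0r.
have dell : differentiable ell k by exact: linear_differentiable.
have dphi' : differentiable phi (ell k).
  by apply/derivable1_diffP; exact: (ex_derive (is_derive := dphi)).
have vE : explicit_value gamma alpha b = phi \o ell by [].
have dv : differentiable (explicit_value gamma alpha b) k.
  by rewrite vE; exact: differentiable_comp.
split=> //; apply/colP => i; rewrite !mxE deriveE// vE diff_comp//=.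
rewrite (diff_lin _ cell) diff1E//= derive1E (derive_val (is_derive := dphi)).
by rewrite /GRing.scale/= dotv_delta mulrC.
Qed.

Lemma continuous_grad_explicit_value k : half_space b k ->
  {for k, continuous (grad (explicit_value gamma alpha b))}.
Proof.
move=> k0; have gE : \near k, (alpha `^ gamma * dotv k b `^ (- gamma)) *: b =
    grad (explicit_value gamma alpha b) k.
  near=> x; apply/esym; apply: (differentiable_explicit_value _).2.
  by near: x; apply: open_nbhs_nbhs; split; first exact: open_half_space.
rewrite /prop_for /continuous_at -(nbhs_singleton gE).
apply: (cvg_trans (near_eq_cvg gE)).
have h := @is_derive1_powR R (- gamma) (dotv k b) k0.
have cp : {for dotv k b, continuous (fun s : R => s `^ (- gamma))}.
  apply/differentiable_continuous/derivable1_diffP.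
  exact: (ex_derive (is_derive := h)).
apply: cvgZr_tmp; apply: cvgMl_tmp.
exact: (continuous_comp (@continuous_dotv _ _ b k) cp).
Unshelve. all: by end_near. Qed.

End explicit_value.

Section profile.
Context {R : realType} {n : nat}.
Variables (p : 'I_n -> R) (gamma alpha delta : R) (b : 'cV[R]_n).
Hypotheses (p_gt0 : forall i, 0 < p i) (gamma_gt0 : 0 < gamma)
  (gamma_neq1 : gamma != 1) (b_gt0 : pos_cone b) (alpha_gt0 : 0 < alpha)
  (PhiE : Phi p gamma b = alpha * delta).
Implicit Types (k c : 'cV[R]_n) (s : R).

(** The feedback consumption at any state whose pairing with [b] is [s]: both [F *m k] and the
    explicit control have this form. *)
Definition profile s : 'cV[R]_n :=
  \col_i (alpha^-1 * (p i / b i 0) `^ gamma^-1 * s).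

Lemma feedback_profile k : feedback p gamma alpha b *m k = profile (dotv k b).
Proof.
apply/colP => i; rewrite !mxE /dotv mulr_sumr; apply: eq_bigr => j _.
by rewrite mxE -!mulrA [b j 0 * _]mulrC.
Qed.

Lemma profile_gt0 s : 0 < s -> pos_cone (profile s).
Proof.
move=> s0 i; rewrite mxE !mulr_gt0 ?invr_gt0// powR_gt0// divr_gt0//.
Qed.

Lemma profile_ge0 s : 0 <= s -> nneg_cone (profile s).
Proof.
move=> s0 i; rewrite mxE !mulr_ge0 ?invr_ge0 ?powR_ge0//; exact: ltW.
Qed.

(** The origin of the powers [1 / gamma] in the feedback: they invert marginal utility, so that the
    gradient of the welfare becomes collinear with [b] and equals the gradient of the explicit value
    function at [<k, b> = s]. *)
Lemma marginal_profile s : 0 < s ->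
  marginal_welfare p gamma (profile s) = (alpha `^ gamma * s `^ (- gamma)) *: b.
Proof.
move=> s0; apply/colP => i; rewrite !mxE.
have bi : 0 < b i 0 := b_gt0 i.
have pi := p_gt0 i.
have pb : 0 < p i / b i 0 by rewrite divr_gt0.
have ai : 0 < alpha^-1 by rewrite invr_gt0.
rewrite (@powRM _ (alpha^-1 * _)) ?mulr_ge0 ?powR_ge0 ?(ltW ai) ?(ltW s0)//.
rewrite (@powRM _ alpha^-1) ?powR_ge0 ?(ltW ai)//.
have -> : ((p i / b i 0) `^ gamma^-1) `^ (- gamma) = b i 0 / p i.
  by rewrite -powRrM mulrN mulVf ?gt_eqF// powR_inv1 ?(ltW pb)// invf_div.
have -> : alpha^-1 `^ (- gamma) = alpha `^ gamma.
  by rewrite -(powR_inv1 (ltW alpha_gt0)) -powRrM mulN1r opprK.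
by field; rewrite gt_eqF.
Qed.

(** Pairing the profile with [b] produces exactly the sum [Phi], divided by [alpha]. *)
Lemma dotv_profile s : dotv (profile s) b = s * delta.
Proof.
rewrite -[delta](mulKf (lt0r_neq0 alpha_gt0)) -PhiE /Phi /dotv !mulr_sumr.
apply: eq_bigr => i _; rewrite mxE.
have bi : 0 < b i 0 := b_gt0 i.
have -> : (gamma - 1) / gamma = 1 - gamma^-1.
  by rewrite mulrBl mul1r divff// gt_eqF.
have -> : (p i / b i 0) `^ gamma^-1 = p i `^ gamma^-1 * b i 0 `^ (- gamma^-1).
  rewrite powRM ?(ltW (p_gt0 i)) ?invr_ge0 ?(ltW bi)//.
  by rewrite -(powR_inv1 (ltW bi)) -powRrM mulN1r.
rewrite powRD ?(gt_eqF bi) ?implybT// powRr1 ?(ltW bi)//.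
ring.
Qed.

(** Euler's identity for a function homogeneous of degree [1 - gamma]: welfare is the pairing with
    its own gradient, divided by [1 - gamma]. *)
Lemma sum_profile s : 0 < s ->
  \sum_i p i * (profile s i 0 `^ (1 - gamma) / (1 - gamma)) =
  alpha `^ gamma * s `^ (1 - gamma) * delta / (1 - gamma).
Proof.
move=> s0.
transitivity (dotv (profile s) (marginal_welfare p gamma (profile s)) / (1 - gamma)).
  rewrite /dotv mulr_suml; apply: eq_bigr => i _; rewrite [marginal_welfare _ _ _ _ _]mxE.
  have yi : 0 < profile s i 0 := profile_gt0 s0 i.
  by rewrite powRD ?(gt_eqF yi) ?implybT// powRr1 ?(ltW yi)//; ring.
rewrite marginal_profile// dotvZr dotv_profile powRD ?(gt_eqF s0) ?implybT//.
by rewrite powRr1 ?(ltW s0)//; ring.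
Qed.

Lemma welfare_profile s : 0 < s -> welfare p gamma (profile s) =
  (alpha `^ gamma * s `^ (1 - gamma) * delta / (1 - gamma))%:E.
Proof. by move=> s0; rewrite welfareE ?sum_profile//; exact: profile_gt0. Qed.

(** The tangent bound at the profile; the factor [gamma / (1 - gamma)] is [1 / (1 - gamma) - 1]. *)
Lemma welfare_le_profile s c : 0 < s -> nneg_cone c ->
  (welfare p gamma c <= (alpha `^ gamma * s `^ (- gamma) *
     (gamma / (1 - gamma) * (s * delta) + dotv c b))%:E)%E.
Proof.
move=> s0 c0; have := welfare_tangent p_gt0 gamma_gt0 gamma_neq1 (profile_gt0 s0) c0.
move/le_trans; apply; rewrite lee_fin sum_profile// marginal_profile// !dotvZr.
rewrite dotv_profile powRD ?(gt_eqF s0) ?implybT// powRr1 ?(ltW s0)//.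
have g1 : 1 - gamma != 0 by rewrite subr_eq0 eq_sym.
by rewrite le_eqVlt; apply/orP; left; apply/eqP; field.
Qed.

Lemma hamiltonian_profile s : 0 < s ->
  hamiltonian p gamma ((alpha `^ gamma * s `^ (- gamma)) *: b) =
  (alpha `^ gamma * s `^ (- gamma) * (gamma / (1 - gamma) * (s * delta)))%:E.
Proof.
move=> s0; rewrite -marginal_profile// hamiltonian_marginalE//; last exact: profile_gt0.
rewrite hamiltonian_cv_marginalE; last exact: profile_gt0.
rewrite sum_profile// marginal_profile// dotvZr dotv_profile.
rewrite powRD ?(gt_eqF s0) ?implybT// powRr1 ?(ltW s0)//.
have g1 : 1 - gamma != 0 by rewrite subr_eq0 eq_sym.
by congr EFin; field.
Qed.

End profile.

(** * Payoff bounds *)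

Section Rintegral_sum.
Context {d : measure_display} {T : measurableType d} {R : realType}.
Variables (mu : {measure set T -> \bar R}) (D : set T).
Hypothesis mD : measurable D.

Lemma integrable_EFin_sum (I : Type) (s : seq I) (h : I -> T -> R) :
  (forall i, mu.-integrable D (EFin \o h i)) ->
  mu.-integrable D (EFin \o (fun x => \sum_(i <- s) h i x)).
Proof.
move=> ih; rewrite (_ : _ \o _ = fun x => (\sum_(i <- s) (EFin \o h i) x)%E).
  by apply: integrable_sum.
by apply/funext => x; rewrite /= sumEFin.
Qed.

Lemma Rintegral_sum (I : Type) (s : seq I) (h : I -> T -> R) :
  (forall i, mu.-integrable D (EFin \o h i)) ->
  \int[mu]_(x in D) (\sum_(i <- s) h i x) = \sum_(i <- s) \int[mu]_(x in D) h i x.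
Proof.
move=> ih; elim: s => [|i s IH].
  rewrite big_nil; under eq_Rintegral do rewrite big_nil.
  by rewrite Rintegral_cst// mul0r.
rewrite big_cons -IH -RintegralD//; last exact: integrable_EFin_sum.
by apply: eq_Rintegral => x _; rewrite big_cons.
Qed.

Lemma integrable_EFinZl (r : R) (h : T -> R) :
  mu.-integrable D (EFin \o h) -> mu.-integrable D (EFin \o (fun x => r * h x)).
Proof.
move=> ih; rewrite (_ : _ \o _ = (fun x => r%:E * (EFin \o h) x)%E)//.
exact: integrableZl.
Qed.

End Rintegral_sum.

Section trajectory.
Context {R : realType} {n : nat}.
Local Notation mu := (@lebesgue_measure R).
Variables (M : 'M[R]_n).
Implicit Types (k b : 'cV[R]_n) (K C : R -> 'cV[R]_n) (i : 'I_n) (t : R).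

Lemma within_continuous_coord (A : set R) K i : {within A, continuous K} ->
  {within A, continuous (fun t => K t i 0)}.
Proof.
move=> cK t; apply: (continuous_comp (g := fun v : 'cV[R]_n => v i 0) (cK t)).
exact: coord_continuous.
Qed.

Lemma within_continuous_mulmx (A : set R) K i : {within A, continuous K} ->
  {within A, continuous (fun t => (M *m K t) i 0)}.
Proof.
move=> cK; under eq_fun do rewrite mxE.
move=> t; apply: (cvg_big _ (nbhs_filter _)) => [|j _]; first exact: add_continuous.
by apply: cvgM; [exact: cvg_cst|exact: within_continuous_coord].
Qed.

Lemma integrable_within_continuous (x : R -> R) t :
  {within `[0, +oo[, continuous x} -> mu.-integrable `[0, t] (EFin \o x).
Proof.
move=> cx; apply: continuous_compact_integrable; first exact: segment_compact.
by apply: continuous_subspaceW cx => s /=; rewrite !in_itv/= andbT => /andP[].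
Qed.

Lemma trajectory_integrable k C K i t : control C -> trajectory M k C K ->
  0 <= t -> mu.-integrable `[0, t] (EFin \o (fun s => (M *m K s - C s) i 0)).
Proof.
move=> [_ iC] [cK _] t0.
pose f1 s := (M *m K s) i 0; pose f2 s := C s i 0.
rewrite (_ : _ \o _ = ((EFin \o f1) \- (EFin \o f2))%E); last first.
  by apply/funext => s; rewrite /= /f1 /f2 [in LHS]mxE [in X in _ + X]mxE.
apply: integrableB => //; last exact: iC.
exact/integrable_within_continuous/within_continuous_mulmx.
Qed.

Lemma trajectory_dotv k C K b l t : control C -> trajectory M k C K ->
  M^T *m b = l *: b -> 0 <= t ->
  dotv (K t) b = dotv k b +
    \int[mu]_(s in `[0, t]) (l * dotv (K s) b - dotv (C s) b).
Proof.
move=> hC hK Mb t0.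
have -> : \int[mu]_(s in `[0, t]) (l * dotv (K s) b - dotv (C s) b) =
    \sum_i \int[mu]_(s in `[0, t]) (b i 0 * (M *m K s - C s) i 0).
  rewrite -Rintegral_sum//; last first.
    by move=> i; apply: integrable_EFinZl => //; exact: trajectory_integrable hC hK t0.
  apply: eq_Rintegral => s _; rewrite -dotvZr -Mb -dotv_mulmx /dotv -sumrB.
  by apply: eq_bigr => i _; rewrite [in RHS]mxE [in X in _ = _ * (_ + X)]mxE; ring.
rewrite /dotv -big_split/=; apply: eq_bigr => i _.
rewrite RintegralZl//; last exact: trajectory_integrable hC hK t0.
by rewrite hK.2// mulrDl [b i 0 * _]mulrC.
Qed.

Lemma trajectory_budget k C K b l : control C -> trajectory M k C K ->
  M^T *m b = l *: b -> 0 <= l -> pos_cone b ->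
  (forall t, 0 <= t -> 0 <= dotv (K t) b) ->
  mu.-integrable `[0, +oo[ (EFin \o (fun t => expR (- l * t) * dotv (C t) b)) /\
  (\int[mu]_(t in `[0%R, +oo[) (expR (- l * t) * dotv (C t) b)%:E
     <= (dotv k b)%:E)%E.
Proof.
move=> hC hK Mb l0 b0 K0.
have iCb T : 0 <= T -> mu.-integrable `[0, T] (EFin \o (fun t => dotv (C t) b)).
  move=> T0; apply: integrable_EFin_sum => // i.
  rewrite (_ : (fun _ => _) = fun t => b i 0 * C t i 0).
    by apply: integrable_EFinZl => //; exact: hC.2.
  by apply/funext => t; rewrite mulrC.
have Cb0 t : 0 <= t -> 0 <= dotv (C t) b.
  by move=> t0; apply: dotv_ge0 => //; exact: hC.1.
apply: ge0_improper_integral_le.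
- by move=> t t0; rewrite mulr_ge0 ?expR_ge0 ?Cb0.
- by move=> T T0; exact/integrable_mul_expR/iCb.
- move=> T T0.
  have cx : {within `[0, +oo[, continuous (fun t => dotv (K t) b)}.
    move=> t; apply: (continuous_comp (g := fun v => dotv v b) (hK.1 t)).
    exact: continuous_dotv.
  have xE t : 0 <= t -> _ := @trajectory_dotv k C K b l t hC hK Mb.
  (* The terminal term [exp (- l T) <K T, b>] is nonnegative and simply dropped for each [T], so its
     limit never has to be known. *)
  rewrite (weighted_budget l0 cx Cb0 iCb xE T0).
  by rewrite gerBl mulr_ge0 ?expR_ge0 ?K0.
Qed.

End trajectory.

Section payoff.
Context {R : realType} {n : nat}.
Local Notation mu := (@lebesgue_measure R).
Variables (p : 'I_n -> R) (gamma rho alpha delta g l : R) (b : 'cV[R]_n).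
Hypotheses (p_gt0 : forall i, 0 < p i) (gamma_gt0 : 0 < gamma)
  (gamma_neq1 : gamma != 1) (b_gt0 : pos_cone b) (alpha_gt0 : 0 < alpha)
  (delta_gt0 : 0 < delta) (PhiE : Phi p gamma b = alpha * delta)
  (deltaE : gamma * delta = rho - l * (1 - gamma))
  (gE : gamma * g = l - rho).
Implicit Types (k : 'cV[R]_n) (C : R -> 'cV[R]_n) (s t : R).

(** Growth rate of the uncontrolled scalar state, minus the rate [delta] at which the profile
    consumes it. *)
Let gl : g = l - delta.
Proof.
apply: (mulfI (lt0r_neq0 gamma_gt0)); rewrite gE mulrBr deltaE; ring.
Qed.

Lemma powR_exp_growth s t a : 0 < s ->
  (s * expR (g * t)) `^ a = s `^ a * expR (a * g * t).
Proof.
by move=> s0; rewrite powRM ?expR_ge0 ?ltW// -expRM; congr (_ * expR _); ring.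
Qed.

Lemma payoff_profile s : 0 < s ->
  payoff p gamma rho (fun t => profile p gamma alpha b (s * expR (g * t))) =
  (alpha `^ gamma / (1 - gamma) * s `^ (1 - gamma))%:E.
Proof.
move=> s0; have [iE intE] := improper_exp_integral delta_gt0.
rewrite /payoff -[RHS]mule1 -intE -integralZl//.
apply: eq_integral => t _.
have st : 0 < s * expR (g * t) by rewrite mulr_gt0 ?expR_gt0.
rewrite (welfare_profile p_gt0 gamma_gt0 b_gt0 alpha_gt0 PhiE st) -!EFinM.
rewrite powR_exp_growth//; congr EFin.
(* Since [rho - (1 - gamma) g = delta], discounted welfare is a constant times the exponential
   density of rate [delta]. *)
have -> : expR (- delta * t) = expR (- (rho * t)) * expR ((1 - gamma) * g * t).
  rewrite -expRD; congr expR.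
  have -> : (1 - gamma) * g = g - (l - rho) by rewrite -gE; ring.
  by rewrite gl; ring.
ring.
Qed.

(** The tangent is taken along the explicit control of a level [s >= <k, b>] rather than of [<k, b>]
    itself: a positive [s] remains available when [k = 0]. *)
Lemma payoff_le (M : 'M[R]_n) k C K s : control C -> trajectory M k C K ->
  M^T *m b = l *: b -> 0 <= l -> (forall t, 0 <= t -> 0 <= dotv (K t) b) ->
  0 < s -> dotv k b <= s ->
  (payoff p gamma rho C <= (alpha `^ gamma / (1 - gamma) * s `^ (1 - gamma))%:E)%E.
Proof.
move=> hC hK Mb l0 K0 s0 ks.
have [iE intE] := improper_exp_integral delta_gt0.
have [iB leB] := trajectory_budget hC hK Mb l0 b_gt0 K0.
have g1 : 1 - gamma != 0 by rewrite subr_eq0 eq_sym.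
have gN : - gamma * g = rho - l by rewrite mulNr gE opprB.
pose kappa := alpha `^ gamma * s `^ (- gamma).
have kappa0 : 0 < kappa by rewrite mulr_gt0 ?powR_gt0.
pose c1 := kappa * s * (gamma / (1 - gamma)).
(* The discounted tangent bound: its part free of [C] integrates to [c1], and the part in [C] is the
   integrand of the budget constraint. *)
pose h t := c1 * (delta * expR (- delta * t)) + kappa * (expR (- l * t) * dotv (C t) b).
have i1 := @integrable_EFinZl _ _ _ mu `[0, +oo[%classic (measurable_itv _) c1 _ iE.
have i2 := @integrable_EFinZl _ _ _ mu `[0, +oo[%classic (measurable_itv _) kappa _ iB.
have ih : mu.-integrable `[0, +oo[ (EFin \o h) by exact: integrableD i1 i2.
apply: (@le_trans _ _ (\int[mu]_(t in `[0%R, +oo[) (h t)%:E)%E).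
  apply: le_integral_integrable => //; first exact: measurable_discounted_welfare.
  move=> t /=; rewrite in_itv/= andbT => t0.
  have st : 0 < s * expR (g * t) by rewrite mulr_gt0 ?expR_gt0.
  have := welfare_le_profile p_gt0 gamma_gt0 gamma_neq1 b_gt0 alpha_gt0 PhiE st (hC.1 t t0).
  rewrite powR_exp_growth// -(@lee_pmul2l _ (expR (- (rho * t)))%:E) ?lte_fin ?expR_gt0//.
  move/le_trans; apply; rewrite -EFinM lee_fin le_eqVlt; apply/orP; left; apply/eqP.
  rewrite /h /c1 /kappa.
  have -> : expR (- l * t) = expR (- (rho * t)) * expR (- gamma * g * t).
    rewrite -expRD; congr expR.
    by rewrite gN; ring.
  have -> : expR (- delta * t) =
      expR (- (rho * t)) * expR (- gamma * g * t) * expR (g * t).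
    rewrite -!expRD; congr expR.
    by rewrite gN gl; ring.
  ring.
rewrite (_ : (\int[mu]_(t in `[0%R, +oo[) (h t)%:E = c1%:E + kappa%:E *
    \int[mu]_(t in `[0%R, +oo[) (expR (- l * t) * dotv (C t) b)%:E)%E); last first.
  by rewrite -[c1%:E]mule1 -intE -!integralZl// -integralD.
apply: (@le_trans _ _ (c1%:E + kappa%:E * s%:E)%E).
  by rewrite leeD2l// lee_pmul2l ?lte_fin// (le_trans leB)// lee_fin.
rewrite -EFinM -EFinD lee_fin le_eqVlt; apply/orP; left; apply/eqP.
rewrite /c1 /kappa powRD ?(gt_eqF s0) ?implybT// powRr1 ?(ltW s0)//.
by field.
Qed.

End payoff.

(** * Locality of the HJB equation *)

Section near_eq.
Context {R : numFieldType} {V W : normedModType R}.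

Lemma near_eq_differentiable (f h : V -> W) (x : V) :
  (\near x, f x = h x) -> differentiable f x -> differentiable h x.
Proof.
move=> fh df; have [cdf /eqaddoP fE] := (diff_locallyP _ _).1 df.
have hE : h \o shift x = cst (h x) + 'd f x +o_ 0 id.
  apply/eqaddoP => e e0; have := fE e e0; rewrite -(nbhs_singleton fh).
  have sh : \forall y \near 0, f (y + x) = h (y + x).
    by have /nbhs0P := fh; apply: filterS => y; rewrite addrC.
  apply: filterS2 sh => y /= fhy.
  by rewrite -[(h \o shift x - _) y]/(h (y + x) - _ y) -fhy.
have dE := diff_unique cdf hE.
by apply/diff_locallyP; rewrite dE; split.
Qed.

End near_eq.

Section hjb.
Context {R : realType} {n : nat}.

(** The value function is identified with [v] on the half-space only. As this set is open,
    differentiability, gradients and their continuity carry over. *)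
Lemma hjb_solution_eq (p : 'I_n -> R) (gamma rho : R) (M : 'M[R]_n)
    (S S' : set 'cV[R]_n) (v w : 'cV[R]_n -> \bar R) :
  open S -> {in S, v =1 w} -> S' `<=` S ->
  hjb_solution p gamma rho M S v -> hjb_solution p gamma rho M S' w.
Proof.
move=> oS vw S'S hv k /S'S Sk /=.
have near_S x : S x -> \forall y \near x, S y.
  by move=> Sx; apply: open_nbhs_nbhs; split.
have near_vw x : S x -> \forall y \near x, fine (v y) = fine (w y).
  by move=> Sx; near=> y; rewrite vw// inE; near: y; exact: near_S.
have gradE x : S x -> grad (fine \o v) x = grad (fine \o w) x.
  move=> Sx; apply/colP => i; rewrite !mxE.
  by apply: near_eq_derive; exact: near_vw.
have [v_fin dv cv vE] := hv k Sk.
split.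
- by rewrite -vw ?inE.
- exact: near_eq_differentiable (near_vw _ Sk) dv.
- have gE : \near k, grad (fine \o v) k = grad (fine \o w) k.
    by near=> x; apply: gradE; near: x; exact: near_S.
  rewrite /prop_for /continuous_at -gradE//.
  exact: (cvg_trans (near_eq_cvg gE) cv).
- rewrite -(vw k (mem_set Sk)).
  rewrite -[grad (fun y => fine (w y)) k]/(grad (fine \o w) k) -(gradE k Sk).
  exact: vE.
Unshelve. all: by end_near. Qed.

End hjb.

(** * The explicit control *)

Section explicit_control.
Context {R : realType} {n : nat}.
Local Notation mu := (@lebesgue_measure R).
Variables (p : 'I_n -> R) (gamma rho alpha delta g l : R) (b : 'cV[R]_n)
  (M : 'M[R]_n).
Hypotheses (p_gt0 : forall i, 0 < p i) (gamma_gt0 : 0 < gamma)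
  (gamma_neq1 : gamma != 1) (b_gt0 : pos_cone b) (alpha_gt0 : 0 < alpha)
  (delta_gt0 : 0 < delta) (PhiE : Phi p gamma b = alpha * delta)
  (deltaE : gamma * delta = rho - l * (1 - gamma))
  (gE : gamma * g = l - rho) (l_ge0 : 0 <= l) (Mb : M^T *m b = l *: b).
Implicit Types (k : 'cV[R]_n) (s t : R) (S : set 'cV[R]_n).

Local Notation F := (feedback p gamma alpha b).
Local Notation Chat := (explicit_control p gamma alpha g b).
Local Notation v := (explicit_value gamma alpha b).

Lemma explicit_controlE k :
  Chat k = fun t => profile p gamma alpha b (dotv k b * expR (g * t)).
Proof.
by apply/funext => t; apply/colP => i; rewrite !mxE -!mulrA.
Qed.

(** [F] has rank one, [F x = <x, b> profile 1], so the eigenvalue is [<profile 1, b>]. *)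
Lemma tr_feedback : F^T *m b = delta *: b.
Proof.
apply/colP => i; rewrite !mxE -[delta]mul1r.
rewrite -(dotv_profile p_gt0 gamma_gt0 b_gt0 alpha_gt0 PhiE).
rewrite /dotv mulr_suml; apply: eq_bigr => j _; rewrite !mxE; ring.
Qed.

Lemma tr_closed_loop : (M - F)^T *m b = g *: b.
Proof.
rewrite linearB/= mulmxBl Mb tr_feedback -scalerBl; congr (_ *: _).
apply: (mulfI (lt0r_neq0 gamma_gt0)); rewrite gE mulrBr deltaE; ring.
Qed.

Lemma closed_loop_control k K t : linear_ode_solution (M - F) k K -> 0 <= t ->
  F *m K t = Chat k t.
Proof.
move=> hK t0; rewrite feedback_profile explicit_controlE.
by rewrite (linear_ode_solution_exp hK tr_closed_loop t0).
Qed.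

Lemma continuous_explicit_control k i : continuous (fun t => Chat k t i 0).
Proof.
move=> t; under eq_fun do rewrite mxE.
apply: cvgMl_tmp; apply: (continuous_comp (g := expR)); last exact: continuous_expR.
by apply: cvgMl_tmp; exact: cvg_id.
Qed.

Lemma control_explicit_control k : 0 <= dotv k b -> control (Chat k).
Proof.
move=> k0; split=> [t _|i T _].
  by rewrite explicit_controlE; apply: profile_ge0 => //; rewrite mulr_ge0 ?expR_ge0.
apply: (@integrable_within_continuous R (fun t => Chat k t i 0)).
exact/continuous_subspaceT/continuous_explicit_control.
Qed.

Lemma lin_sol_solution (c : R) (N : 'M[R]_n) k : linear_ode_solution N k (lin_sol c N k).
Proof.
rewrite -[X in linear_ode_solution _ X _](lin_sol0 c N k).
by apply: derive_linear_ode_solution => t i; exact: is_derive_lin_sol.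
Qed.

(** The closed-loop flow is the trajectory driven by its own feedback, seen as an open-loop control.
    The shift [c] stays free because positivity of the flow will call for a large one. *)
Lemma trajectory_lin_sol (c : R) k : trajectory M k (Chat k) (lin_sol c (M - F) k).
Proof.
set K := lin_sol c (M - F) k.
have hK : linear_ode_solution (M - F) k K by exact: lin_sol_solution.
have dK t i := is_derive_lin_sol c (M - F) k i t.
have cK : continuous K.
  move=> t; have /is_derive_cVP d := dK t.
  by apply/differentiable_continuous/derivable1_diffP; exact: (ex_derive (is_derive := d)).
split; first exact: continuous_subspaceT.
move=> t i; rewrite le_eqVlt => /predU1P[<-|t0].
  by rewrite set_itv1 Rintegral_set1 addr0 /K lin_sol0.
have -> : \int[mu]_(s in `[0, t]) (M *m K s - Chat k s) i 0 =
    \int[mu]_(s in `[0, t]) ((M - F) *m K s) i 0.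
  apply: eq_Rintegral => s; rewrite inE/= in_itv/= => /andP[s0 _].
  by rewrite -(closed_loop_control hK s0) mulmxBl.
rewrite /Rintegral.
rewrite (@continuous_FTC2 R _ (fun s => K s i 0) 0 t t0).
- have -> : k = K 0 by rewrite /K lin_sol0.
  by rewrite -EFinB/= [RHS]addrC subrK.
- exact/within_continuous_mulmx/continuous_subspaceT.
- have cKi s : {for s, continuous (fun s => K s i 0)}.
    apply/differentiable_continuous/derivable1_diffP.
    exact: (ex_derive (is_derive := dK s i)).
  split.
  + by move=> s _; exact: (ex_derive (is_derive := dK s i)).
  + by apply: cvg_at_right_filter; exact: cKi.
  + by apply: cvg_at_left_filter; exact: cKi.
- by move=> s _; rewrite derive1E; exact: (derive_val (is_derive := dK s i)).
Qed.

Lemma admissible_half_space k : half_space b k -> admissible M (half_space b) k (Chat k).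
Proof.
move=> k0; split; first by apply: control_explicit_control; exact: ltW.
exists (lin_sol 0 (M - F) k); split=> [|t t0]; first exact: trajectory_lin_sol.
have hK := lin_sol_solution 0 (M - F) k.
by rewrite /half_space/= (linear_ode_solution_exp hK tr_closed_loop t0) mulr_gt0 ?expR_gt0.
Qed.

Lemma payoff_explicit_control k : half_space b k ->
  payoff p gamma rho (Chat k) = (v k)%:E.
Proof.
move=> k0; rewrite explicit_controlE.
exact: (payoff_profile p_gt0 gamma_gt0 b_gt0 alpha_gt0 delta_gt0 PhiE deltaE gE k0).
Qed.

Lemma admissible_payoff_le S k C s : S `<=` [set x | 0 <= dotv x b] ->
  admissible M S k C -> 0 < s -> dotv k b <= s ->
  (payoff p gamma rho C <= (alpha `^ gamma / (1 - gamma) * s `^ (1 - gamma))%:E)%E.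
Proof.
move=> S0 [hC [K [hK SK]]] s0 ks.
by apply: (payoff_le p_gt0 gamma_gt0 gamma_neq1 b_gt0 alpha_gt0 delta_gt0 PhiE
  deltaE gE hC hK Mb l_ge0 _ s0 ks) => t t0; exact/S0/SK.
Qed.

(** Any state constraint inside the closed half-space is allowed, so one argument serves both the
    auxiliary and the original problem. *)
Lemma explicit_control_optimal S k : S `<=` [set x | 0 <= dotv x b] ->
  half_space b k -> admissible M S k (Chat k) ->
  optimal p gamma rho M S k (Chat k) /\ value p gamma rho M S k = (v k)%:E.
Proof.
move=> S0 k0 adm.
have vE : value p gamma rho M S k = (v k)%:E.
  apply/eqP; rewrite eq_le; apply/andP; split.
    apply: ge_ereal_sup => _ [C hC <-].
    exact: (admissible_payoff_le S0 hC k0 (lexx _)).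
  rewrite -payoff_explicit_control//.
  by apply: ereal_sup_ubound; exists (Chat k).
by split=> //; split=> //; rewrite payoff_explicit_control// -vE.
Qed.

(* The starting point [0] satisfies the payoff bound for every [s > 0]; let [s]
   tend to [0]. *)
Lemma explicit_control0_optimal S : S `<=` [set x | 0 <= dotv x b] ->
  admissible M S 0 (Chat 0) -> optimal p gamma rho M S 0 (Chat 0).
Proof.
move=> S0 adm; split=> //; apply/eqP; rewrite eq_le; apply/andP; split.
  by apply: ereal_sup_ubound; exists (Chat 0).
apply: ge_ereal_sup => _ [C hC <-].
have g1 : 1 - gamma != 0 by rewrite subr_eq0 eq_sym.
have ag : 0 < alpha `^ gamma by exact: powR_gt0.
have dot0 : dotv 0 b = 0 by rewrite /dotv big1// => i _; rewrite mxE mul0r.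
(* Every [r] with the sign of [1 - gamma] is the bound for some [s], found by solving for [s]. So
   payoffs are at most 0 when [gamma < 1], and equal to [-oo] when [gamma > 1]. *)
have C_le r : 0 < r * (1 - gamma) -> (payoff p gamma rho C <= r%:E)%E.
  move=> r0; pose s := (r * (1 - gamma) / alpha `^ gamma) `^ (1 - gamma)^-1.
  have s0 : 0 < s by rewrite powR_gt0// divr_gt0.
  have := admissible_payoff_le S0 hC s0.
  rewrite dot0 => /(_ (ltW s0)); rewrite /s -powRrM mulVf// powRr1; last first.
    by rewrite divr_ge0 ?ltW.
  move/le_trans; apply; rewrite lee_fin le_eqVlt; apply/orP; left; apply/eqP.
  by field; rewrite g1 gt_eqF.
have [gamma1|gamma1] := ltP gamma 1.
- apply: (@le_trans _ _ 0%E).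
    apply/lee_addgt0Pr => e e0; rewrite add0e; apply: C_le.
    by rewrite mulr_gt0// subr_gt0.
  apply: integral_ge0 => t /=; rewrite in_itv/= andbT => t0.
  rewrite mule_ge0 ?lee_fin ?expR_ge0//; apply: sume_ge0 => i _.
  apply: mule_ge0; first by rewrite lee_fin ltW.
  rewrite /crra ltNge (ltW gamma1)/= lee_fin.
  by rewrite divr_ge0 ?powR_ge0// subr_ge0 ltW.
- have {}gamma1 : 1 < gamma by rewrite lt_neqAle eq_sym gamma_neq1.
  have {}C_le r : r < 0 -> (payoff p gamma rho C <= r%:E)%E.
    by move=> r0; apply: C_le; rewrite nmulr_rgt0 ?subr_lt0.
  suff -> : payoff p gamma rho C = -oo%E by exact: leNye.
  move: C_le; case: (payoff p gamma rho C) => [x| |] // C_le.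
    exfalso; have := C_le (- (`|x| + 1)); rewrite oppr_lt0 ltr_wpDl// => /(_ isT).
    by rewrite lee_fin; have := ler_norm (- x); rewrite normrN; lra.
  by have := C_le (-1); rewrite ltrN10 => /(_ isT).
Qed.

Lemma nneg_cone_dotv : @nneg_cone R n `<=` [set x | 0 <= dotv x b].
Proof. by move=> x x0; exact: dotv_ge0. Qed.

Lemma admissible_nneg_cone k : (forall i j, i != j -> F i j <= M i j) ->
  nneg_cone k -> admissible M (@nneg_cone R n) k (Chat k).
Proof.
move=> FM k0; split; first by apply: control_explicit_control; exact: nneg_cone_dotv.
(* Large enough to outweigh every negative diagonal entry of [M - F]. *)
pose c := \sum_i `|(M - F) i i|.
exists (lin_sol c (M - F) k); split=> [|t t0]; first exact: trajectory_lin_sol.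
apply: lin_sol_ge0 => // i j; rewrite [leRHS]mxE [X in _ + X]mxE.
have [->|ij] := eqVneq i j; last first.
  by rewrite mulr0n addr0 !mxE subr_ge0; have := FM i j ij; rewrite mxE.
rewrite mulr1n /c (bigD1 j)//= addrA addr_ge0 ?sumr_ge0//.
by rewrite -lerBlDl sub0r -normrN ler_norm.
Qed.

Lemma admissible_delta_feedback_le i j : i != j ->
  admissible M (@nneg_cone R n) (delta_mx j 0) (Chat (delta_mx j 0)) ->
  F i j <= M i j.
Proof.
move=> ij [hC [K [hK K0]]]; rewrite leNgt; apply/negP => MF.
set k := delta_mx j 0 in hC hK *.
pose phi (s : R) : R := (M *m K s - Chat k s) i 0.
have K0E : K 0 = k.
  by apply/colP => m; rewrite hK.2// set_itv1 Rintegral_set1 addr0.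
have phi0 : phi 0 = M i j - F i j.
  rewrite /phi K0E explicit_controlE !mxE mulr0 expR0 mulr1 dotv_delta.
  congr (_ - _); rewrite (bigD1 j)//= big1 ?addr0 => [|m mj].
    by rewrite mxE !eqxx mulr1.
  by rewrite mxE (negbTE mj) mulr0.
have phi_lt0 : phi 0 < 0 by rewrite phi0 subr_lt0.
have cphi : {within `[0, +oo[, continuous phi}.
  have cMK := @within_continuous_mulmx R n M _ K i hK.1.
  have cC : {within `[0, +oo[, continuous (fun s => Chat k s i 0)}.
    exact/continuous_subspaceT/continuous_explicit_control.
  rewrite (_ : phi = fun s => (M *m K s) i 0 - Chat k s i 0).
    by move=> s; apply: cvgB; [exact: cMK|exact: cC].
  by apply/funext => s; rewrite /phi mxE [X in _ + X]mxE.
have [_ cphi0] := (continuous_within_itvcyP _ _).1 cphi.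
(* [phi 0] is negative, so half of it is larger. By continuity [phi] stays below this negative
   constant on [[0, d]], and integrating drives the [i]-th coordinate, which starts at 0, below 0 at
   time [d]. *)
have half : phi 0 < phi 0 / 2 by lra.
have [e /= e0 he] := cvgr_lt _ cphi0 _ half.
pose d := e / 2.
have d0 : 0 < d by rewrite divr_gt0.
have phi_le s : `[0, d]%classic s -> phi s <= phi 0 / 2.
  rewrite /= in_itv/= => /andP[]; rewrite le_eqVlt => /predU1P[<- _|s0 sd].
    exact: ltW.
  apply/ltW/he => //=; rewrite sub0r normrN gtr0_norm//.
  by apply: le_lt_trans sd _; rewrite /d; lra.
have iphi : mu.-integrable `[0, d] (EFin \o phi).
  exact: (trajectory_integrable i hC hK (ltW d0)).
have icst : mu.-integrable `[0, d] (EFin \o (fun=> phi 0 / 2)).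
  apply: integrable_within_continuous; apply: continuous_subspaceT.
  exact: cst_continuous.
have := K0 d (ltW d0) i; rewrite hK.2 ?(ltW d0)//.
rewrite [k i 0]mxE (negbTE ij) add0r leNgt => /negP; apply.
apply: le_lt_trans (le_Rintegral _ iphi icst phi_le) _ => //.
have mud : mu `[0, d] = d%:E.
  by rewrite lebesgue_measure_itv/= lte_fin d0 -EFinB subr0.
rewrite Rintegral_cst// [X in fine X]mud/=.
by rewrite pmulr_llt0//; lra.
Qed.

Lemma hjb_explicit_value :
  hjb_solution p gamma rho M (half_space b) (fun k => (v k)%:E).
Proof.
move=> k Xk /=; have k0 : 0 < dotv k b := Xk.
have [dv gradv] := differentiable_explicit_value alpha gamma_neq1 Xk.
have cg := continuous_grad_explicit_value (alpha := alpha) gamma_neq1 Xk.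
have hamE := hamiltonian_profile p_gt0 gamma_gt0 gamma_neq1 b_gt0 alpha_gt0 PhiE k0.
split=> //; rewrite -[grad _ k]/(grad v k) gradv hamE.
rewrite -EFinM -EFinD dotvZr dotv_mulmx Mb dotvZr; congr EFin.
have g1 : 1 - gamma != 0 by rewrite subr_eq0 eq_sym.
(* Both sides are multiples of [alpha ^ gamma <k, b> ^ (1 - gamma)]; the equation reduces to this
   relation divided by [1 - gamma]. *)
have -> : rho = gamma * delta + l * (1 - gamma) by rewrite deltaE subrK.
rewrite /explicit_value powRD ?(gt_eqF k0) ?implybT// powRr1 ?(ltW k0)//.
by field.
Qed.

Lemma attains_hamiltonian_explicit_value k c : half_space b k ->
  attains_sup (@nneg_cone R n) (hamiltonian_cv p gamma (grad v k)) c <->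
  c = F *m k.
Proof.
move=> Xk; have k0 : 0 < dotv k b := Xk.
have [_ ->] := differentiable_explicit_value alpha gamma_neq1 Xk.
rewrite feedback_profile -(marginal_profile p_gt0 gamma_gt0 b_gt0 alpha_gt0 k0).
apply: attains_hamiltonian_marginal => //; exact: profile_gt0.
Qed.

End explicit_control.

(** * The matrix [L + A] and the sign of its positive eigenvector's eigenvalue *)

Section laplacian.
Context {R : realType} {n : nat}.
Variables (W : 'M[R]_n) (a : 'I_n -> R).
Hypothesis W_sym : W^T = W.

Local Notation M := (laplacian W + diag_mx (\row_i a i)).

Lemma tr_laplacian : M^T = M.
Proof.
have Wji i j : W j i = W i j by rewrite -{1}W_sym mxE.
apply/matrixP => i j; rewrite !mxE.
have [->//|ij] := eqVneq j i.
by rewrite Wji.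
Qed.

Lemma laplacian_offdiag i j : i != j -> M i j = W i j.
Proof. by move=> ij; rewrite !mxE (negbTE ij) mulr0n addr0. Qed.

Lemma laplacian_const1 : M *m const_mx 1 = \col_i a i.
Proof.
apply/colP => i; rewrite !mxE (bigD1 i)//= !mxE eqxx mulr1n mulr1.
rewrite (eq_bigr (fun j => W i j)); last first.
  by move=> j ji; rewrite !mxE eq_sym (negbTE ji) mulr0n addr0 mulr1.
by rewrite addrAC addNr add0r.
Qed.

(** The rows of the Laplacian sum to 0, so pairing the eigenvector equation with the constant vector
    1 gives [l <b, 1> = <b, a> >= 0]. This sign makes the weights [exp (- l t)] monotone in the
    budget constraint. *)
Lemma laplacian_eigenvalue_ge0 (l : R) (b : 'cV[R]_n) :
  (forall i, 0 < a i) -> pos_cone b -> b != 0 -> M *m b = l *: b -> 0 <= l.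
Proof.
move=> a0 b0 bn0 Mb.
have one0 : pos_cone (const_mx 1 : 'cV[R]_n) by move=> i; rewrite mxE.
have b1 : 0 < dotv b (const_mx 1).
  by apply: dotv_gt0 => // i; exact/ltW/(b0 i).
have : l * dotv b (const_mx 1) = dotv b (\col_i a i).
  by rewrite -laplacian_const1 dotvC -dotvZr -Mb dotvC dotv_mulmx tr_laplacian.
have : 0 <= dotv b (\col_i a i).
  by apply: dotv_ge0 => i; [exact/ltW/(b0 i)|rewrite mxE].
by move=> h1 h2; rewrite -(pmulr_lge0 _ b1) h2.
Qed.

End laplacian.

Theorem theorem5p7 (R : realType) (n : nat) (hn : (2 <= n)%N)
    (rho gamma : R) (hrho : 0 < rho) (hgamma : 0 < gamma) (hgamma1 : gamma != 1)
    (p : 'I_n -> R) (hp : forall i, 0 < p i)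
    (a : 'I_n -> R) (ha : forall i, 0 < a i)
    (W : 'M[R]_n) (hW : graph_weights W) (hconn : graph_connected W)
    (lambda0 : R) (b0 : 'cV[R]_n)
    (hlambda0 : largest_eigenvalue (laplacian W + diag_mx (\row_i a i)) lambda0)
    (hb0 : pos_unit_eigenvector (laplacian W + diag_mx (\row_i a i)) lambda0 b0)
    (hlt : lambda0 * (1 - gamma) < rho) :
  let M := laplacian W + diag_mx (\row_i a i) in
  let X := half_space b0 in
  let Rn_plus := @nneg_cone R n in
  let Rn_plusplus := @pos_cone R n in
  let alpha := gamma * Phi p gamma b0 / (rho - lambda0 * (1 - gamma)) in
  let v := explicit_value gamma alpha b0 in
  let F := feedback p gamma alpha b0 in
  let g := (lambda0 - rho) / gamma in
  let Chat := explicit_control p gamma alpha g b0 in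
  let V := value p gamma rho M Rn_plus in
  let Vb0 := value p gamma rho M X in
  (* (i) *)
  hjb_solution p gamma rho M X (fun k => (v k)%:E) /\
  (* (ii) *)
  (forall k, X k ->
     forall c, attains_sup Rn_plus (hamiltonian_cv p gamma (grad v k)) c
               <-> c = F *m k) /\
  (* (iii) *)
  eigenpair (M - F)^T g b0 /\
  (* (iv) *)
  (forall k, exists K, linear_ode_solution (M - F) k K /\
     forall K', linear_ode_solution (M - F) k K' ->
       forall t, 0 <= t -> K' t = K t) /\
  (forall k K, X k -> linear_ode_solution (M - F) k K ->
     forall t, 0 <= t ->
       dotv (K t) b0 = dotv k b0 * expR (g * t) /\ X (K t)) /\
  (* (v) *)
  (forall k, X k ->
     (forall K, linear_ode_solution (M - F) k K ->
        forall t, 0 <= t -> F *m K t = Chat k t) /\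
     admissible M X k (Chat k) /\
     optimal p gamma rho M X k (Chat k) /\
     Vb0 k = (v k)%:E /\
     (admissible M Rn_plus k (Chat k) ->
        optimal p gamma rho M Rn_plus k (Chat k) /\ V k = Vb0 k)) /\
  (* (vi) *)
  ((forall k, Rn_plus k -> optimal p gamma rho M Rn_plus k (Chat k))
     <-> (forall i j, i != j -> F i j <= W i j)) /\
  ((forall i j, i != j -> F i j <= W i j) ->
     (forall k, Rn_plus k -> k != 0 -> V k = Vb0 k) /\
     hjb_solution p gamma rho M Rn_plusplus Vb0).
Proof.
move=> M X Rn_plus Rn_plusplus alpha v F g Chat V Vb0.
have [W_sym _ _] := hW.
have [[b_neq0 Mb] b_gt0 _] := hb0.
have n_gt0 : (0 < n)%N by exact: ltn_trans hn.
pose delta := (rho - lambda0 * (1 - gamma)) / gamma.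
have delta_gt0 : 0 < delta by rewrite divr_gt0// subr_gt0.
have deltaE : gamma * delta = rho - lambda0 * (1 - gamma).
  by rewrite mulrC divfK// gt_eqF.
have gE : gamma * g = lambda0 - rho by rewrite mulrC divfK// gt_eqF.
have Phi_gt0 : 0 < Phi p gamma b0.
  rewrite /Phi (bigD1 (Ordinal n_gt0))//= ltr_wpDr//.
    by apply: sumr_ge0 => i _; rewrite mulr_ge0 ?powR_ge0.
  by rewrite mulr_gt0// powR_gt0//; exact: (b_gt0 _).
have alpha_gt0 : 0 < alpha by rewrite divr_gt0 ?mulr_gt0// subr_gt0.
have PhiE : Phi p gamma b0 = alpha * delta.
  rewrite /alpha /delta; field; rewrite (gt_eqF hgamma)/=.
  by rewrite gt_eqF// subr_gt0.
have MbT : M^T *m b0 = lambda0 *: b0 by rewrite tr_laplacian.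
have l_ge0 := laplacian_eigenvalue_ge0 W_sym ha b_gt0 b_neq0 Mb.
have M_off i j : i != j -> M i j = W i j := @laplacian_offdiag R n W a i j.
have FMb := tr_closed_loop hp hgamma b_gt0 alpha_gt0 PhiE deltaE gE MbT.
have X_nneg : X `<=` [set x | 0 <= dotv x b0] by move=> x; exact: ltW.
have Rn_nneg := nneg_cone_dotv b_gt0.
have hjbX := hjb_explicit_value hp hgamma hgamma1 b_gt0 alpha_gt0 PhiE deltaE MbT.
have admX := admissible_half_space hp hgamma b_gt0 alpha_gt0 PhiE deltaE gE MbT.
have opt := explicit_control_optimal hp hgamma hgamma1 b_gt0 alpha_gt0 delta_gt0
  PhiE deltaE gE l_ge0 MbT.
have adm_nneg := admissible_nneg_cone hp hgamma b_gt0 alpha_gt0 PhiE deltaE gE MbT.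
have Vb0E k : X k -> Vb0 k = (v k)%:E.
  by move=> Xk; have [] := opt _ _ X_nneg Xk (admX _ Xk).
have X_pos k : Rn_plus k -> k != 0 -> X k by move=> k0 kn0; exact: dotv_gt0.
have FM : (forall i j, i != j -> F i j <= W i j) ->
    forall i j, i != j -> F i j <= M i j.
  by move=> FW i j ij; rewrite M_off ?FW.
split; first exact: hjbX.
split; first by move=> k Xk c; exact: attains_hamiltonian_explicit_value.
split; first by split.
split.
  move=> k; exists (lin_sol 0 (M - F) k); split; first exact: lin_sol_solution.
  move=> K' hK' t t0.
  exact: (linear_ode_solution_unique hK' (lin_sol_solution 0 (M - F) k) t0).
split.
  move=> k K Xk hK t t0; have E := linear_ode_solution_exp hK FMb t0.
  by split=> //; rewrite /X /half_space/= E mulr_gt0 ?expR_gt0.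
split.
  move=> k Xk; split.
    move=> K hK t t0.
    exact: (closed_loop_control hp hgamma b_gt0 alpha_gt0 PhiE deltaE gE MbT hK t0).
  split; first exact: admX.
  split; first by have [] := opt _ _ X_nneg Xk (admX _ Xk).
  split; first exact: Vb0E.
  move=> adm; have [optk Vk] := opt _ _ Rn_nneg Xk adm.
  by split=> //; rewrite Vb0E.
split; first split.
- move=> optk i j ij; rewrite -M_off//.
  have delta_nneg : Rn_plus (delta_mx j 0) by move=> m; rewrite mxE; case: andP.
  by have [adm _] := optk _ delta_nneg; exact: (admissible_delta_feedback_le ij adm).
- move=> FW k k0; have adm := adm_nneg k (FM FW) k0.
  (* A nonzero vector of the cone lies in the half-space because [b0] is strictly positive; the
     origin does not. *)
  have [kE|kn0] := eqVneq k 0.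
    rewrite kE in adm *.
    exact: (explicit_control0_optimal hp hgamma hgamma1 b_gt0 alpha_gt0 delta_gt0
      PhiE deltaE gE l_ge0 MbT Rn_nneg adm).
  by have [] := opt _ _ Rn_nneg (X_pos _ k0 kn0) adm.
- move=> FW; split.
    move=> k k0 kn0; have Xk := X_pos _ k0 kn0.
    by rewrite (Vb0E _ Xk); exact: (opt _ _ Rn_nneg Xk (adm_nneg k (FM FW) k0)).2.
  apply: (@hjb_solution_eq R n p gamma rho M X _ (fun k => (v k)%:E) _ _ _ _ hjbX).
    exact: open_half_space.
    by move=> k; rewrite inE => Xk; rewrite Vb0E.
  move=> k k0; apply: X_pos; first by move=> i; exact/ltW/(k0 i).
  apply/eqP => kE; have := k0 (Ordinal n_gt0); rewrite kE mxE ltxx//.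
Qed.
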